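(* Let $\mathcal T$ be a set of tile designs for the regular dodecahedron with symmetry group the full icosahedral group $I_h$ (order $120$). Suppose there are $t_{\mathrm{id}}$ tiles, of which $t_r$ are fixed under $72^\circ$ rotation and $t_f$ are fixed under (horizontal) reflection of the regular pentagonal face. Then the number of ways of tiling the faces of the dodecahedron up to full icosahedral symmetry $I_h$ is $$\frac{1}{120}\left(t_{\mathrm{id}}^{12}+24t_{\mathrm{id}}^2t_r^2+20t_{\mathrm{id}}^4+15t_{\mathrm{id}}^6+t_{\mathrm{id}}^6+24t_rt_{\mathrm{id}}+20t_{\mathrm{id}}^2+15t_{\mathrm{id}}^4t_f^4\right).$$
   Context: Tilings. Let $P$ be a polyhedron with set of faces $\mathcal F$ and let $\mathcal A$ be a group of isometries of $P$, acting on $\mathcal F$. A set of tile designs is a finite set $\mathcal T$ together with a group action of $\mathcal A$ on $\mathcal T\times\mathcal F$ lying over the action on $\mathcal F$ (so $A\cdot(T,F)=(T',A\cdot F)$ for some $T'\in\mathcal T$). A tiling is a map $\tau:\mathcal F\to\mathcal T$; $\mathcal A$ acts on tilings by moving graphs: $A\cdot\tau$ is the tiling with $((A\cdot\tau)(A\cdot F),A\cdot F)=A\cdot(\tau(F),F)$ for all $F$. The number of ways of tiling up to $\mathcal A$ is the number of $\mathcal A$-orbits on the set of tilings. The induced symmetry group $G$ of a face $F$ is the group of isometries of $F$ realized by elements of the stabilizer $\mathcal A_F$; for $g\in G$, $t_g$ is the number of $T\in\mathcal T$ with $g\cdot(T,F)=(T,F)$, where $g$ acts via the element of $\mathcal A_F$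 inducing it. Since $\mathcal A$ acts transitively on faces, $t_g$ does not depend on the choice of $F$. In particular $t_{\mathrm{id}}=|\mathcal T|$. Polyhedron and group. Let $\phi=(1+\sqrt5)/2$. Here $\mathcal A=I_h$ is the group of order $120$ generated by $R_0=\mathrm{diag}(-1,1,1)$, $R_2=\mathrm{diag}(1,-1,1)$ and $R_1=\frac12\begin{pmatrix}1-\phi&-\phi&-1\\-\phi&1&1-\phi\\-1&1-\phi&\phi\end{pmatrix}$. The dodecahedron is the convex hull of the $I_h$-orbit of $(1,1,1)$ ($20$ vertices, $12$ regular pentagonal faces). The induced symmetry group of a face is $D_5=\langle r,f\mid r^5=f^2=(rf)^2=e\rangle$, with $r$ a $72^\circ$ rotation and $f$ a reflection of the pentagon. *)

(* Defs.v *)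
From HB Require Import structures.
From mathcomp Require Import all_boot all_order all_algebra.
From mathcomp Require Import all_classical all_reals all_analysis.

Set Implicit Arguments.
Unset Strict Implicit.
Unset Printing Implicit Defensive.

Import Order.TTheory GRing.Theory Num.Theory.

Local Open Scope classical_set_scope.
Local Open Scope ring_scope.

Section Geometry.
Context {R : realType}.
Implicit Types (P F : set 'cV[R]_3) (p u v n : 'cV[R]_3) (A : 'M[R]_3).

Definition dot u v : R := (u^T *m v) 0 0.

Definition convex_hull P : set 'cV[R]_3 := smallest (@convex_set R 'cV[R]_3) P.

(* Two-dimensional faces only: the last clause excludes edges and vertices. *)
Definition faces P : set (set 'cV[R]_3) :=
  [set F | (exists n (c : R), [/\ n != 0, forall x, P x -> dot n x <= c &
                                F = [set x | P x /\ dot n x = c]]) /\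
           (exists x y z, [/\ F x, F y, F z & free [:: y - x; z - x]])].

Definition mx_image A F : set 'cV[R]_3 := [set A *m x | x in F].

Definition generated_group (S : set 'M[R]_3) : set 'M[R]_3 :=
  smallest [set H | [/\ H 1, forall A B, H A -> H B -> H (A * B) &
                        forall A, H A -> H A^-1]] S.

Definition stabilizer (G : set 'M[R]_3) F : set 'M[R]_3 :=
  [set A | G A /\ mx_image A F = F].

(* (p; u, v) is an orthonormal frame of a plane containing F. *)
Definition plane_frame F p u v : Prop :=
  [/\ dot u u = 1, dot v v = 1, dot u v = 0 &
      forall x, F x -> exists a b, x = p + a *: u + b *: v].

(* The frame may have either orientation, so that this covers the rotations by
   theta and by - theta. *)
Definition rotates_face (theta : R) A F : Prop :=
  exists p u v, plane_frame F p u v /\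
    forall a b, F (p + a *: u + b *: v) ->
      A *m (p + a *: u + b *: v) =
        p + (a * cos theta - b * sin theta) *: u
          + (a * sin theta + b * cos theta) *: v.

Definition reflects_face A F : Prop :=
  exists p u v, plane_frame F p u v /\
    forall a b, F (p + a *: u + b *: v) ->
      A *m (p + a *: u + b *: v) = p + a *: u - b *: v.

End Geometry.

Section Tilings.
Context {R : realType}.

(* T is the set of designs and G a group of isometries of P.  The action of G on
   T * faces P is given by a function on all matrices, of which only the values
   on G are constrained and used. *)
Record tile_designs (G : set 'M[R]_3) (P : set 'cV[R]_3) (T : finType) := {
  tile_act : 'M[R]_3 -> T * faces P -> T * faces P;
  tile_act1 : forall x, tile_act 1 x = x;
  tile_actM : forall A B x, G A -> G B ->
    tile_act (A * B) x = tile_act A (tile_act B x);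
  tile_act_face : forall A x, G A -> val (tile_act A x).2 = mx_image A (val x.2)
}.

Context {G : set 'M[R]_3} {P : set 'cV[R]_3} {T : finType}.
Variable D : tile_designs G P T.

Definition tiling_graph (tau : faces P -> T) : set (T * faces P) :=
  [set x | x.1 = tau x.2].

Definition tiling_orbit (tau : faces P -> T) : set (faces P -> T) :=
  [set tau' | exists2 A, G A & tiling_graph tau' = tile_act D A @` tiling_graph tau].

Definition tiling_orbits : set (set (faces P -> T)) := range tiling_orbit.

Definition fixed_designs (A : 'M[R]_3) (F : faces P) : {set T} :=
  [set t | tile_act D A (t, F) == (t, F)]%SET.

End Tilings.

Section Dodecahedron.
Variable R : realType.

Definition golden_ratio : R := (1 + Num.sqrt 5) / 2.

Local Notation phi := golden_ratio.

Definition mx3 (rows : seq (seq R)) : 'M[R]_3 := \matrix_(i, j) (nth [::] rows i)`_j.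

Definition R0 : 'M[R]_3 := mx3 [:: [:: -1; 0; 0]; [:: 0; 1; 0]; [:: 0; 0; 1]].

Definition R1 : 'M[R]_3 := 2^-1 *: mx3
  [:: [:: 1 - phi; - phi; -1]; [:: - phi; 1; 1 - phi]; [:: -1; 1 - phi; phi]].

Definition R2 : 'M[R]_3 := mx3 [:: [:: 1; 0; 0]; [:: 0; -1; 0]; [:: 0; 0; 1]].

Definition Ih : set 'M[R]_3 := generated_group [set R0; R1; R2].

Definition dodecahedron : set 'cV[R]_3 :=
  convex_hull [set A *m const_mx 1 | A in Ih].

End Dodecahedron.

Arguments Ih : clear implicits.
Arguments dodecahedron : clear implicits.

(* Main.v *)
Require Import Defs.
From Stdlib Require Import ZArith.
From HB Require Import structures.
From mathcomp Require Import all_boot all_order all_fingroup all_algebra.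
From mathcomp Require Import all_classical all_reals all_analysis.
From mathcomp Require Import ssrZ zify ring lra.

Set Implicit Arguments.
Unset Strict Implicit.
Unset Printing Implicit Defensive.

Import Order.TTheory GRing.Theory Num.Theory.

(** The formula is Burnside's lemma: 120 times the number of orbits is the sum,
    over the elements g of I_h, of the number of tilings fixed by g
    ([card_tiling_orbits]).  A tiling fixed by g is determined by its values on
    one face of each cycle of g.  If a face i lies on a cycle of length k, then
    g^k stabilizes i, and a design t may be chosen at i exactly when g^k fixes
    (t, i); so the number of tilings fixed by g is a product over the cycles
    ([card_fixed_tilings]).  The stabilizer of a face is dihedral of order 10,
    hence g^k is trivial on the face, a nontrivial rotation or a reflection.
    Which designs an element fixes depends only on the subgroup it generates,
    and the stabilizers of all faces are conjugate, their nontrivial rotations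
    generate conjugate subgroups, and their reflections are conjugate.  So the
    number of designs fixed by g^k is t_id, t_r or t_f according to these three
    cases ([returning_holonomy]), and the contribution of g is a monomial
    ([card_fixed]).  The eight terms of the formula are the eight kinds of
    elements: the identity; the 24 rotations of order 5, with two fixed faces
    and two 5-cycles; the 20 of order 3; the 15 of order 2; and the negatives
    of all of these, in the same order.  Only the 15 reflections, negatives of
    the rotations of order 2, have reflections of faces among their holonomies:
    each fixes four faces and acts on them by reflection.

    The geometry is reduced to finitely many exact verifications.  The 20
    vertices and the normals of the 12 faces have coordinates in Z[phi], where
    equalities and inequalities are decided by integer arithmetic.  The
    generators R0, R1 and R2 are symmetric matrices which permute the vertices
    and the normals.  A matrix is determined by its effect on the normals, so
    I_h is isomorphic to the group generated by three explicit permutations of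
    12 objects, of which all elements can be listed.

    That the dodecahedron has no faces other than these 12 ([facesP]) comes from
    its vertices: a supporting plane that meets it in a set of dimension 2
    contains three linearly independent vertices ([exposed_face_vertices]), and
    for every such triple the plane through it either has vertices on both sides
    or is one of the 12 planes ([facet_testP]). *)

(** * Burnside's lemma for tilings *)

Section BurnsideTilings.
Local Open Scope group_scope.
Variables (gT : finGroupType) (I T : finType).
Variables (toI : {action gT &-> I}) (to : {action gT &-> T * I}).
Hypothesis act_over : forall x g, (to x g).2 = toI x.2 g.
Implicit Types (tau : {ffun I -> T}) (g h : gT) (i : I) (t : T).

Definition moved tau g : {ffun I -> T} :=
  [ffun i => (to (tau (toI i g^-1), toI i g^-1) g).1].

Lemma movedE tau g i : to (tau i, i) g = (moved tau g (toI i g), toI i g).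
Proof. by rewrite ffunE actK [LHS]surjective_pairing act_over. Qed.

Lemma moved_is_action : is_action [set: gT] moved.
Proof.
apply: is_total_action => [tau | tau g h]; apply/ffunP=> i.
  by rewrite ffunE invg1 act1 act1.
have := movedE tau (g * h) (toI i (g * h)^-1); rewrite actKV => /(congr1 fst) /= <-.
rewrite actM movedE movedE /= -!actM; congr (moved _ _ _).
by rewrite mulVg act1.
Qed.
Canonical moved_action := Action moved_is_action.

Lemma fixed_tilingP tau g :
  reflect (forall i, to (tau i, i) g = (tau (toI i g), toI i g))
          (tau \in 'Fix_moved_action[g]).
Proof.
apply: (iffP afix1P) => [tau_g i | tau_g]; first by rewrite movedE [moved _ _]tau_g.
by apply/ffunP=> i; rewrite /= ffunE tau_g actKV.
Qed.

(** Empty unless toI i g = i. *)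
Definition returning g i : {set T} := [set t | to (t, i) g == (t, i)].

Lemma actX_iter i g k : toI i (g ^+ k) = iter k (toI^~ g) i.
Proof. by elim: k => [|k IHk]; rewrite ?expg0 ?act1 // expgSr actM IHk. Qed.

(** The action of g carries the designs at i bijectively to the designs at
    toI i g, and intertwines h with its conjugate. *)
Lemma returning_conj g h i : #|returning (h ^ g) (toI i g)| = #|returning h i|.
Proof.
pose carry t := (to (t, i) g).1.
have carryE t : to (t, i) g = (carry t, toI i g).
  by rewrite [LHS]surjective_pairing act_over.
have carry_inj : injective carry.
  by move=> t t' tt'; have := act_inj to g (etrans (carryE t)
    (etrans (congr1 (pair^~ _) tt') (esym (carryE t')))) => -[].
have carryV t : ((to (t, toI i g) g^-1).1, i) = to (t, toI i g) g^-1.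
  by rewrite [RHS]surjective_pairing act_over actK.
rewrite -(card_imset (mem (returning h i)) carry_inj); apply: eq_card => t.
apply/idP/imsetP => [|[t' + ->]]; rewrite !inE; last first.
  by move=> /eqP t'_fix; rewrite -carryE -actM conjgE mulKVg actM t'_fix.
move=> /eqP t_fix; exists (to (t, toI i g) g^-1).1; last by rewrite /carry carryV actKV.
rewrite inE carryV; apply/eqP/(act_inj to g).
by rewrite actKV -!actM -conjgE t_fix.
Qed.

Lemma returningX h k i : returning h i \subset returning (h ^+ k) i.
Proof.
apply/fintype.subsetP=> t; rewrite !inE => /eqP t_h.
by elim: k => [|k IHk]; rewrite ?expg0 ?act1 // expgSr actM (eqP IHk) t_h.
Qed.

(** The two hypotheses say that h1 and the conjugate of h2 by g are powers of
    each other, i.e. generate the same subgroup; an element fixes at least what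
    another element fixes when it is a power of it. *)
Lemma card_returning_cyclic h1 h2 g i a b :
    h1 ^+ a = h2 ^ g -> h1 = (h2 ^+ b) ^ g ->
  #|returning h1 (toI i g)| = #|returning h2 i|.
Proof.
move=> h1a h1b; apply/eqP; rewrite eqn_leq; apply/andP; split.
  by rewrite -(returning_conj g h2) -h1a subset_leq_card ?returningX.
by rewrite h1b returning_conj subset_leq_card ?returningX.
Qed.

(** The first power of g that stabilizes i: the holonomy of the cycle through i. *)
Definition first_return g i : gT := g ^+ fingraph.order (toI^~ g) i.

(** A fixed tiling satisfies tau (toI i g) = the transport of tau i by g, so it is
    determined by one value on each cycle, and the only constraint on this value
    is that transport once around the cycle gives it back.  The function rep
    picks the same face in every cycle from all of its members; keeping it
    abstract allows for a choice that can be computed. *)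
Lemma card_fixed_tilings g (rep : I -> I) (i0 : I) :
    (forall i, rep (toI i g) = rep i) ->
    (forall i, fconnect (toI^~ g) (rep i) i) ->
  #|'Fix_moved_action[g]| =
    (\prod_(i | rep i == i) #|returning (first_return g i) i|)%N.
Proof.
set f := toI^~ g => rep_f rep_conn.
have f_inj : injective f by apply: act_inj.
have rep_iter k i : rep (iter k f i) = rep i by elim: k => //= k <-; rewrite rep_f.
have rep_rep i : rep (rep i) = rep i.
  by rewrite -{2}(iter_findex (rep_conn i)) rep_iter.
have [T0|/card_gt0P[t0 _]] := posnP #|T|.
  rewrite (bigD1 (rep i0)) ?rep_rep //=.
  have /eqP -> : #|returning (first_return g (rep i0)) (rep i0)| == 0.
    by rewrite -leqn0 -T0 max_card.
  apply: eq_card0 => tau; have := card0_eq T0 (tau i0).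
  by rewrite inE.
(* Fixed tilings are restricted to the representatives; the restriction has
   the arbitrary value t0 elsewhere, so that it is again a total function. *)
pose choices i := if rep i == i then returning (g ^+ fingraph.order f i) i else [set t0].
pose restr tau : {ffun I -> T} := [ffun i => if rep i == i then tau i else t0].
have fixX tau k i : tau \in 'Fix_moved_action[g] ->
    to (tau i, i) (g ^+ k) = (tau (iter k f i), iter k f i).
  move=> /fixed_tilingP tau_g; elim: k => [|k IHk]; first by rewrite expg0 act1.
  by rewrite expgSr actM IHk tau_g.
have restr_inj : {in 'Fix_moved_action[g] &, injective restr}.
  move=> tau tau' tau_g tau'_g /ffunP eq_tau; apply/ffunP=> i.
  have := eq_tau (rep i); rewrite !ffunE rep_rep eqxx => eq_rep.
  have := fixX _ (findex f (rep i) i) (rep i) tau_g.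
  by rewrite eq_rep fixX // iter_findex // => -[].
rewrite -(card_in_imset restr_inj).
transitivity #|family choices|; last first.
  rewrite card_family /image_mem foldrE big_map big_enum /= [RHS]big_mkcond /=.
  by apply: eq_bigr => i _; rewrite /choices; case: eqP => // _; rewrite cards1.
apply: eq_card => sigma; apply/imsetP/familyP => [[tau tau_g ->] i|sigma_fam].
  rewrite ffunE /choices; case: ifP => _; last by rewrite inE.
  by rewrite inE fixX // iter_order.
have sigma_rep i :
    to (sigma (rep i), rep i) (g ^+ fingraph.order f (rep i)) = (sigma (rep i), rep i).
  by have := sigma_fam (rep i); rewrite /choices rep_rep eqxx inE => /eqP.
(* Any choice of designs on the representatives extends to a fixed tiling by
   transport along the cycles. *)
pose tau : {ffun I -> T} :=
  [ffun i => (to (sigma (rep i), rep i) (g ^+ findex f (rep i) i)).1].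
(* The transported value does not depend on the number of turns made around
   the cycle. *)
have tauE i k : iter k f (rep i) = i ->
    to (sigma (rep i), rep i) (g ^+ k) = (tau i, i).
  set o := fingraph.order f (rep i) in sigma_rep * => ik.
  have o_gt0 : 0 < o by rewrite /o -orderSpred.
  have iter_mod : iter (k %% o) f (rep i) = i.
    rewrite -[RHS]ik [in RHS](divn_eq k o) addnC iterD; congr iter.
    by elim: (k %/ o) => //= q IHq; rewrite mulSn iterD -IHq iter_order.
  have findex_mod : findex f (rep i) i = k %% o.
    by rewrite -[X in findex _ _ X]iter_mod findex_iter // ltn_pmod.
  rewrite [LHS]surjective_pairing act_over /= actX_iter ik ffunE findex_mod.
  rewrite {1}(divn_eq k o) expgD actM; congr ((to _ _).1, _).
  elim: (k %/ o) => [|q IHq]; first by rewrite act1.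
  by rewrite mulSn expgD actM sigma_rep.
exists tau; last first.
  apply/ffunP=> i; rewrite ffunE; case: ifPn => [/eqP rep_i|].
    by have := tauE i 0 rep_i; rewrite rep_i act1 => -[].
  by have := sigma_fam i; rewrite /choices; case: eqP => // _; rewrite inE => /eqP.
apply/fixed_tilingP=> i.
have ik := iter_findex (rep_conn i); rewrite -(tauE _ _ ik) -actM -expgSr.
by rewrite -(rep_f i) tauE //= rep_f ik.
Qed.

Theorem card_tiling_orbits :
  (\sum_g #|('Fix_moved_action[g])%g|
    = #|orbit moved_action [set: gT] @: [set: {ffun I -> T}]| * #|gT|)%N.
Proof.
have /Frobenius_Cauchy : [acts [set: gT], on [set: {ffun I -> T}] | moved_action].
  by apply/actsP => g _ x; rewrite !inE.
by rewrite cardsT => <-; apply: eq_big => [g|g _]; rewrite ?inE // finset.setTI.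
Qed.

End BurnsideTilings.

Local Open Scope classical_set_scope.
Local Open Scope card_scope.
Local Open Scope ring_scope.

(** * Exact arithmetic in Z[phi] *)

(** The pair (a, b) stands for a + b phi, with phi^2 = phi + 1. *)
Definition zphi := (Z * Z)%type.
Definition zadd (x y : zphi) : zphi := (Z.add x.1 y.1, Z.add x.2 y.2).
Definition zopp (x : zphi) : zphi := (Z.opp x.1, Z.opp x.2).
Definition zsub (x y : zphi) : zphi := zadd x (zopp y).
Definition zmul (x y : zphi) : zphi :=
  let bd := Z.mul x.2 y.2 in
  (Z.add (Z.mul x.1 y.1) bd, Z.add (Z.add (Z.mul x.1 y.2) (Z.mul x.2 y.1)) bd).
(** Twice a + b phi is s + b sqrt 5 with s = 2 a + b.  This is positive as soon as
    the larger of the two terms in absolute value is positive, and the absolute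
    values are compared through the squares s^2 and 5 b^2. *)
Definition zpos (x : zphi) : bool :=
  let s := Z.add (Z.mul 2 x.1) x.2 in
  let s2 := Z.mul s s in
  let t2 := Z.mul 5 (Z.mul x.2 x.2) in
  (Z.ltb 0 s && Z.ltb t2 s2) || (Z.ltb 0 x.2 && Z.ltb s2 t2).
Definition zzero (x : zphi) : bool := Z.eqb x.1 0 && Z.eqb x.2 0.

Definition zvec := (zphi * zphi * zphi)%type.
Definition zvec_add (u v : zvec) : zvec :=
  (zadd u.1.1 v.1.1, zadd u.1.2 v.1.2, zadd u.2 v.2).
Definition zscale (c : zphi) (u : zvec) : zvec :=
  (zmul c u.1.1, zmul c u.1.2, zmul c u.2).
Definition zdot (u v : zvec) : zphi :=
  zadd (zadd (zmul u.1.1 v.1.1) (zmul u.1.2 v.1.2)) (zmul u.2 v.2).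
Definition zcross (u v : zvec) : zvec :=
  (zsub (zmul u.1.2 v.2) (zmul u.2 v.1.2),
   zsub (zmul u.2 v.1.1) (zmul u.1.1 v.2),
   zsub (zmul u.1.1 v.1.2) (zmul u.1.2 v.1.1)).
Definition zapply (A : zvec * zvec * zvec) (u : zvec) : zvec :=
  (zdot A.1.1 u, zdot A.1.2 u, zdot A.2 u).

Section Eval.
Variable R : realType.
Local Notation phi := (golden_ratio R).

Lemma golden_ratio_sqr : phi * phi = phi + 1.
Proof.
have s5 : Num.sqrt 5 * Num.sqrt 5 = 5 :> R by rewrite -expr2 sqr_sqrtr.
by rewrite /golden_ratio; field: s5.
Qed.

Lemma golden_ratioE : 2 * phi - 1 = Num.sqrt 5 :> R.
Proof. by rewrite /golden_ratio; field. Qed.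

Definition zval (z : Z) : R := (int_of_Z z)%:~R.
Definition zphi_val (x : zphi) : R := zval x.1 + zval x.2 * phi.

Lemma zvalD x y : zval (Z.add x y) = zval x + zval y.
Proof. by rewrite -intrD -(rmorphD int_of_Z). Qed.
Lemma zvalN x : zval (Z.opp x) = - zval x.
Proof. by rewrite -mulrNz -(rmorphN int_of_Z). Qed.
Lemma zvalM x y : zval (Z.mul x y) = zval x * zval y.
Proof. by rewrite -intrM -(rmorphM int_of_Z). Qed.
Lemma zval_lt x y : Z.ltb x y -> zval x < zval y.
Proof. by rewrite ltr_int; lia. Qed.

Lemma zaddE x y : zphi_val (zadd x y) = zphi_val x + zphi_val y.
Proof. by rewrite /zphi_val !zvalD; ring. Qed.
Lemma zoppE x : zphi_val (zopp x) = - zphi_val x.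
Proof. by rewrite /zphi_val !zvalN; ring. Qed.
Lemma zsubE x y : zphi_val (zsub x y) = zphi_val x - zphi_val y.
Proof. by rewrite zaddE zoppE. Qed.
Lemma zmulE x y : zphi_val (zmul x y) = zphi_val x * zphi_val y.
Proof.
rewrite /zphi_val /zmul /= !(zvalD, zvalM).
by ring: golden_ratio_sqr.
Qed.

Lemma zzeroP x : zzero x -> zphi_val x = 0.
Proof.
case: x => a b /andP[] /Z.eqb_eq /= -> /Z.eqb_eq /= ->.
by rewrite /zphi_val /= mul0r addr0.
Qed.

Lemma sum_gt0_of_sqr_lt (x y : R) : 0 < x -> y * y < x * x -> 0 < x + y.
Proof.
move=> x0 yx; rewrite ltNge; apply/negP => xy.
have : 0 <= (x + y) * (y - x) by rewrite mulr_le0 //; lra.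
by nra.
Qed.

Lemma zposP x : zpos x -> 0 < zphi_val x.
Proof.
case: x => a b; rewrite /zpos /zphi_val -[(a, b).1]/a -[(a, b).2]/b.
set s := Z.add (Z.mul 2 a) b.
have -> : zval a + zval b * phi = (zval s + zval b * Num.sqrt 5) / 2.
  by rewrite -golden_ratioE zvalD zvalM; field.
have s5 : Num.sqrt 5 * Num.sqrt 5 = 5 :> R by rewrite -expr2 sqr_sqrtr.
have s50 : 0 < Num.sqrt 5 :> R by rewrite sqrtr_gt0.
move=> /orP[] /andP[/zval_lt + /zval_lt]; rewrite !zvalM.
all: rewrite -[zval (Zpos _)]/(5%:R) -[zval Z0]/(0%:R) => x0 yx.
all: apply: divr_gt0 => //.
  by apply: sum_gt0_of_sqr_lt => //; rewrite mulrACA s5 mulrC.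
by rewrite addrC; apply: sum_gt0_of_sqr_lt; rewrite ?mulr_gt0 // mulrACA s5 [ltRHS]mulrC.
Qed.

(** * Vectors of R^3 *)

Lemma sum3E (V : zmodType) (F : 'I_3 -> V) : \sum_i F i = F 0 + F 1 + F 2.
Proof.
by rewrite !big_ord_recl big_ord0 addr0 addrA; congr (F _ + F _ + F _); apply: val_inj.
Qed.

Lemma ord3_ind (P : 'I_3 -> Prop) : P 0 -> P 1 -> P 2 -> forall i, P i.
Proof.
move=> P0 P1 P2 [[|[|[|//]]] lti].
- by have -> : Ordinal lti = 0 by apply: val_inj.
- by have -> : Ordinal lti = 1 by apply: val_inj.
- by have -> : Ordinal lti = 2 by apply: val_inj.
Qed.

Lemma colP3 (u v : 'cV[R]_3) :
  u 0 0 = v 0 0 -> u 1 0 = v 1 0 -> u 2 0 = v 2 0 -> u = v.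
Proof. by move=> *; apply/colP; apply: ord3_ind. Qed.

Lemma dotE (u v : 'cV[R]_3) :
  dot u v = u 0 0 * v 0 0 + u 1 0 * v 1 0 + u 2 0 * v 2 0.
Proof. by rewrite /dot mxE sum3E !mxE. Qed.

Lemma dotDr (u v w : 'cV[R]_3) : dot u (v + w) = dot u v + dot u w.
Proof. by rewrite !dotE !mxE; ring. Qed.

Lemma dotZr (u v : 'cV[R]_3) a : dot u (a *: v) = a * dot u v.
Proof. by rewrite !dotE !mxE; ring. Qed.

Lemma dotNr (u v : 'cV[R]_3) : dot u (- v) = - dot u v.
Proof. by rewrite -scaleN1r dotZr mulN1r. Qed.

Lemma dotC (u v : 'cV[R]_3) : dot u v = dot v u.
Proof. by rewrite !dotE; ring. Qed.

Lemma dotZl (u v : 'cV[R]_3) a : dot (a *: u) v = a * dot u v.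
Proof. by rewrite dotC dotZr dotC. Qed.

Definition cross (u v : 'cV[R]_3) : 'cV[R]_3 :=
  \col_i [:: u 1 0 * v 2 0 - u 2 0 * v 1 0;
             u 2 0 * v 0 0 - u 0 0 * v 2 0;
             u 0 0 * v 1 0 - u 1 0 * v 0 0]`_i.

Definition det3 (u v w : 'cV[R]_3) : R := dot u (cross v w).

Lemma det3_cycle u v w : det3 u v w = det3 v w u.
Proof. by rewrite /det3 !dotE !mxE /=; ring. Qed.

(** This is Cramer's rule: n is expanded on the basis dual to u, v, w, which
    consists of the cross products divided by the determinant. *)
Lemma det3_expansion (n u v w : 'cV[R]_3) :
  det3 u v w *: n =
    dot n u *: cross v w + dot n v *: cross w u + dot n w *: cross u v.
Proof. by apply: colP3; rewrite /det3 !(dotE, mxE) /=; ring. Qed.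

(** The equation n . x = c of a plane is recovered, up to a factor, from three of
    its points. *)
Lemma det3_plane (n u v w : 'cV[R]_3) c :
    dot n u = c -> dot n v = c -> dot n w = c ->
  det3 u v w *: n = c *: (cross v w + cross w u + cross u v).
Proof. by move=> nu nv nw; rewrite det3_expansion nu nv nw !scalerDr. Qed.

(** Each row of A - B is orthogonal to u, v and w, and thus satisfies
    [det3_plane] with c = 0. *)
Lemma mx3_eq_on_basis (A B : 'M[R]_3) u v w : det3 u v w != 0 ->
  A *m u = B *m u -> A *m v = B *m v -> A *m w = B *m w -> A = B.
Proof.
move=> D0 Au Av Aw; apply/row_matrixP => i.
apply/eqP; rewrite -subr_eq0 -linearB /=; set n := row i (A - B).
have dot0 x : A *m x = B *m x -> dot n^T x = 0.
  by move=> Ax; rewrite /dot trmxK /n -row_mul mulmxBl Ax subrr row0 mxE.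
have := det3_plane (dot0 _ Au) (dot0 _ Av) (dot0 _ Aw).
move/eqP; rewrite scale0r scaler_eq0 (negbTE D0) /= => /eqP n0.
by rewrite -[n]trmxK n0 trmx0.
Qed.

Lemma free_cross (u v : 'cV[R]_3) : free [:: u; v] -> cross u v != 0.
Proof.
move=> /(@freeP _ _ 2 [tuple of [:: u; v]]) uv_free; apply/eqP => uv0.
have coef a b : a *: u + b *: v = 0 -> a = 0 /\ b = 0.
  move=> ab0; have /uv_free ab : \sum_(i < 2) [:: a; b]`_i *: [tuple of [:: u; v]]`_i = 0.
    by rewrite !big_ord_recl big_ord0 addr0.
  by split; [have := ab 0 | have := ab 1].
have c i : cross u v i 0 = 0 by rewrite uv0 mxE.
have [[c0 c1] c2] := (c 0, c 1, c 2); rewrite !mxE /= in c0 c1 c2.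
move/subr0_eq: c0; move/subr0_eq: c1; move/subr0_eq: c2 => c2 c1 c0.
have u0 : u = 0.
  (* The vanishing of the cross product says that v_i u = u_i v for every
     coordinate i, which is a linear relation between u and v. *)
  have ui i : u i 0 = 0.
    have /coef[_ //] : - v i 0 *: u + u i 0 *: v = 0.
    by elim/ord3_ind: i; apply: colP3; rewrite !mxE /=; lra.
  by apply/colP=> i; rewrite ui mxE.
have /coef[/eqP] : 1 *: u + 0 *: v = 0 by rewrite u0 scaler0 scale0r addr0.
by rewrite oner_eq0.
Qed.

Lemma cross_free (u v : 'cV[R]_3) : cross u v != 0 -> free [:: u; v].
Proof.
move=> uv0; apply/(@freeP _ _ 2 [tuple of [:: u; v]]) => k.
rewrite !big_ord_recl big_ord0 addr0 /=.
set a := k ord0; set b := k (lift ord0 ord0) => ab0.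
have az : a *: cross u v = 0.
  transitivity (cross (a *: u + b *: v) v).
    by apply: colP3; rewrite !mxE /=; ring.
  by rewrite ab0; apply: colP3; rewrite !mxE /=; ring.
have bz : b *: cross u v = 0.
  transitivity (cross u (a *: u + b *: v)).
    by apply: colP3; rewrite !mxE /=; ring.
  by rewrite ab0; apply: colP3; rewrite !mxE /=; ring.
move: az bz => /eqP; rewrite scaler_eq0 (negbTE uv0) orbF => /eqP a0.
move=> /eqP; rewrite scaler_eq0 (negbTE uv0) orbF => /eqP b0.
move=> [[|[|m]] lti]; last by case: (m) lti.
- by rewrite -[RHS]a0; congr k; apply: val_inj.
- by rewrite -[RHS]b0; congr k; apply: val_inj.
Qed.

Lemma cross_subE (x y z : 'cV[R]_3) :
  cross (y - x) (z - x) = cross y z + cross z x + cross x y.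
Proof. by apply: colP3; rewrite !mxE /=; ring. Qed.

Definition zvec_val (u : zvec) : 'cV[R]_3 :=
  \col_i [:: zphi_val u.1.1; zphi_val u.1.2; zphi_val u.2]`_i.

Lemma zvec_addE u v : zvec_val (zvec_add u v) = zvec_val u + zvec_val v.
Proof. by apply: colP3; rewrite !mxE /= zaddE. Qed.

Lemma zscaleE c u : zvec_val (zscale c u) = zphi_val c *: zvec_val u.
Proof. by apply: colP3; rewrite !mxE /= zmulE. Qed.

Lemma zdotE u v : zphi_val (zdot u v) = dot (zvec_val u) (zvec_val v).
Proof. by rewrite dotE !mxE /= !zaddE !zmulE. Qed.

Lemma zcrossE u v : zvec_val (zcross u v) = cross (zvec_val u) (zvec_val v).
Proof. by apply: colP3; rewrite !mxE /= zsubE !zmulE. Qed.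

Definition zdet u v w : zphi := zdot u (zcross v w).

Lemma zdetE u v w :
  zphi_val (zdet u v w) = det3 (zvec_val u) (zvec_val v) (zvec_val w).
Proof. by rewrite /zdet zdotE zcrossE. Qed.

End Eval.

(** * Vertices, face normals and generators over Z[phi] *)

Definition pm (x : zphi) : seq zphi := [:: x; zopp x].

Definition cyclic_shifts (x y z : zphi) : seq zvec :=
  [:: (x, y, z); (z, x, y); (y, z, x)].

Definition z0 : zphi := (Z0, Z0).
Definition z1 : zphi := (Zpos 1, Z0).
Definition zgold : zphi := (Z0, Zpos 1).
Definition z2 : zphi := zadd z1 z1.

(** The cube (+-1, +-1, +-1) and the cyclic shifts of (+-phi, +-1/phi, 0), where
    1/phi = phi - 1. *)
Definition zvertices : seq zvec := Eval vm_compute in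
  [seq (xy, z) | xy <- [seq (x, y) | x <- pm z1, y <- pm z1], z <- pm z1]
  ++ flatten [seq cyclic_shifts x y z0 | x <- pm zgold, y <- pm (zsub zgold z1)].

(** The cyclic shifts of (0, +-1, +-phi), the vertices of an icosahedron. *)
Definition znormals : seq zvec := Eval vm_compute in
  flatten [seq cyclic_shifts z0 y z | y <- pm z1, z <- pm zgold].

(** On each face the scalar product with its normal is 1 + phi. *)
Definition zheight : zphi := zadd z1 zgold.

(** The matrices are those of 2 R0, 2 R1 and 2 R2, because R1 has entries in
    (1/2) Z[phi] only; d is 1 - phi. *)
Definition zgens : seq (zvec * zvec * zvec) :=
  let d := zsub z1 zgold in
  [:: ((zopp z2, z0, z0), (z0, z2, z0), (z0, z0, z2));
      ((d, zopp zgold, zopp z1), (zopp zgold, z1, d), (zopp z1, d, zgold));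
      ((z2, z0, z0), (z0, zopp z2, z0), (z0, z0, z2))].

Definition zgen_perm (s : seq zvec) (A : zvec * zvec * zvec) : seq nat :=
  [seq index (zapply A u) [seq zscale z2 v | v <- s] | u <- s].

Definition vertex_tables : seq (seq nat) := Eval vm_compute in
  [seq zgen_perm zvertices A | A <- zgens].

Definition face_tables : seq (seq nat) := Eval vm_compute in
  [seq zgen_perm znormals A | A <- zgens].

Definition zvertex i : zvec := nth (z0, z0, z0) zvertices i.
Definition znormal i : zvec := nth (z0, z0, z0) znormals i.
Definition zgen k := nth ((z0, z0, z0), (z0, z0, z0), (z0, z0, z0)) zgens k.
Definition vertex_table k : seq nat := nth [::] vertex_tables k.
Definition face_table k : seq nat := nth [::] face_tables k.

Lemma all_iotaP n (p : pred nat) : all p (iota 0 n) -> forall i : 'I_n, p i.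
Proof. by move=> /allP p_all i; apply: p_all; rewrite mem_iota ltn_ord. Qed.

Lemma all_iota2P m n (p : nat -> nat -> bool) :
  all (fun k => all (p k) (iota 0 n)) (iota 0 m) -> forall (k : 'I_m) (i : 'I_n), p k i.
Proof. by move=> /all_iotaP p_all k; apply: all_iotaP. Qed.

Lemma vertex_tableP (k : 'I_3) (j : 'I_20) (j' := nth 0%N (vertex_table k) j) :
  zapply (zgen k) (zvertex j) = zscale z2 (zvertex j') /\ (j' < 20)%N.
Proof.
have /all_iota2P/(_ k j)/andP[/eqP //] : all (fun k => all (fun j =>
    let j' := nth 0%N (vertex_table k) j in
    (zapply (zgen k) (zvertex j) == zscale z2 (zvertex j')) && (j' < 20)%N)
  (iota 0 20)) (iota 0 3) by vm_compute.
Qed.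

Lemma face_tableP (k : 'I_3) (i : 'I_12) (i' := nth 0%N (face_table k) i) :
  [/\ zapply (zgen k) (znormal i) = zscale z2 (znormal i'), (i' < 12)%N
    & nth 0%N (face_table k) i' = i].
Proof.
have /all_iota2P/(_ k i)/and3P[/eqP + + /eqP //] : all (fun k => all (fun i =>
    let i' := nth 0%N (face_table k) i in
    [&& zapply (zgen k) (znormal i) == zscale z2 (znormal i'), (i' < 12)%N
      & nth 0%N (face_table k) i' == i])
  (iota 0 12)) (iota 0 3) by vm_compute.
Qed.

Lemma zvertex_le (i : 'I_12) (j : 'I_20)
    (d := zsub zheight (zdot (znormal i) (zvertex j))) : zzero d || zpos d.
Proof.
have /all_iota2P/(_ i j) // : all (fun i => all (fun j =>
    let d := zsub zheight (zdot (znormal i) (zvertex j)) in zzero d || zpos d)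
  (iota 0 20)) (iota 0 12) by vm_compute.
Qed.

Definition on_face i (u : zvec) : bool := zzero (zsub zheight (zdot (znormal i) u)).

Definition face_vertices i : seq zvec := [seq u <- zvertices | on_face i u].

(** This is what makes the 12 faces distinct as sets of points. *)
Lemma face_sepP (i j : 'I_12) : i != j ->
  exists2 u, u \in zvertices & on_face i u && zpos (zsub zheight (zdot (znormal j) u)).
Proof.
rewrite -val_eqE => ij; apply/hasP.
have /all_iota2P/(_ i j)/implyP/(_ ij) // : all (fun i => all (fun j => (i != j) ==>
    has (fun u => on_face i u && zpos (zsub zheight (zdot (znormal j) u))) zvertices)
  (iota 0 12)) (iota 0 12) by vm_compute.
Qed.

Lemma face_basisP (i : 'I_12) : exists u v w,
  [/\ [/\ u \in zvertices, v \in zvertices & w \in zvertices],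
      [/\ on_face i u, on_face i v & on_face i w] & zpos (zdet u v w)].
Proof.
have /all_iotaP/(_ i)/hasP[u + /hasP[v + /hasP[w + uvw]]] : all (fun i =>
    let s := face_vertices i in
    has (fun u => has (fun v => has (fun w => zpos (zdet u v w)) s) s) s)
  (iota 0 12) by vm_compute.
by rewrite !mem_filter => /andP[? ?] /andP[? ?] /andP[? ?]; exists u, v, w.
Qed.

Lemma normal_basisP : exists u v w,
  [/\ u \in znormals, v \in znormals & w \in znormals] /\ zpos (zdet u v w).
Proof.
suff /hasP[u ? /hasP[v ? /hasP[w ? uvw]]] :
    has (fun u => has (fun v => has (fun w => zpos (zdet u v w))
      znormals) znormals) znormals by exists u, v, w.
by vm_compute.
Qed.

(** By [det3_plane], the plane through u, v and w is given by N . x = D.  If it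
    does not contain the origin, then either a vertex x is strictly on the other
    side of it than the origin, i.e. N . x / D > 1, or N and D are proportional
    to the data of one of the 12 faces. *)
Definition facet_test (u v w : zvec) : bool :=
  let D := zdet u v w in
  if zzero D then true else
  let N := zvec_add (zvec_add (zcross v w) (zcross w u)) (zcross u v) in
  if has (fun x => zpos (zmul D (zsub (zdot N x) D))) zvertices then true
  else has (fun n => zscale zheight N == zscale D n) znormals.

Lemma facet_testP : {in zvertices & &, forall u v w, facet_test u v w}.
Proof.
move=> u v w uV vV wV.
have /allP/(_ u uV)/allP/(_ v vV)/allP/(_ w wV) // : all (fun u => all (fun v =>
  all (facet_test u v) zvertices) zvertices) zvertices.
by vm_compute.
Qed.

Lemma zvertex_opp u : u \in zvertices -> zscale (zopp z1) u \in zvertices.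
Proof.
by move: u; apply/allP; vm_compute.
Qed.

(** * Lists of images: the 120 face permutations and their cycles *)

Section Closure.
Variables (X : eqType) (m : nat) (gen : nat -> X -> X).

Definition insert (x : X) (s : seq X) := if x \in s then s else x :: s.

(** Iterating this map computes the orbit of the elements of s under the maps gen k
    for k < m. *)
Definition closure_step (s : seq X) := foldr insert s [seq gen k x | k <- iota 0 m, x <- s].

Lemma closure_ind (P : X -> Prop) n (s : seq X) :
    {in s, forall x, P x} ->
    (forall k x, (k < m)%N -> P x -> P (gen k x)) ->
  {in iter n closure_step s, forall x, P x}.
Proof.
move=> P_s P_gen; elim: n => //= n; set s' := iter n _ s => P_s'.
suff : {in [seq gen k x | k <- iota 0 m, x <- s'], forall x, P x}.
  rewrite /closure_step; elim: [seq _ | _ <- _, _ <- _] => //= y t IHt P_yt.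
  have P_t : {in t, forall x, P x} by move=> z zt; apply: P_yt; rewrite inE zt orbT.
  move=> x; rewrite /insert; case: ifP => _; first exact: IHt.
  by rewrite inE => /predU1P[-> | /IHt]; [apply: P_yt; rewrite mem_head | apply].
move=> _ /allpairsP[[k x] [/= + x_s ->]]; rewrite mem_iota => k_m.
by apply: P_gen => //; apply: P_s'.
Qed.

End Closure.

Definition perm_at (l : seq nat) i : nat := nth 0%N l i.
Definition after (l m : seq nat) : seq nat := [seq perm_at l i | i <- m].
Definition list_id : seq nat := iota 0 12.

(** The permutation s is represented by the list of s 0, ..., s 11.  Every element
    of the group is a product of at most 15 generators, as 15 is the number of
    reflections; that the list is closed under the generators is verified in
    [face_perms_closed]. *)
Definition face_perms : seq (seq nat) := Eval vm_compute in
  iter 15 (closure_step 3 (fun k => after (face_table k))) [:: list_id].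

Lemma face_permsE :
  face_perms = iter 15 (closure_step 3 (fun k => after (face_table k))) [:: list_id].
Proof. by vm_compute. Qed.

Lemma face_perms_uniq : uniq face_perms.
Proof. by vm_compute. Qed.

Lemma face_perms_id : list_id \in face_perms.
Proof. by vm_compute. Qed.

Lemma face_perms_closed k l : (k < 3)%N -> l \in face_perms ->
  after (face_table k) l \in face_perms.
Proof.
move=> k3; move: l; apply/allP.
have := @all_iotaP 3 (fun k => all (fun l => after (face_table k) l \in face_perms) face_perms).
by move=> /(_ _ (Ordinal k3)); apply; vm_compute.
Qed.

Definition vertices_reached : seq nat :=
  iter 15 (closure_step 3 (fun k => perm_at (vertex_table k))) [:: 0%N].

Lemma vertices_reachedP (j : 'I_20) : val j \in vertices_reached.
Proof. by move: j; apply: (@all_iotaP 20 (fun j => j \in vertices_reached)); vm_compute. Qed.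

Definition list_cycle (l : seq nat) i : seq nat := traject (perm_at l) i 12.
(** The least element of the cycle through i; a cycle has at most 12 elements. *)
Definition list_root l i : nat := foldr minn i (list_cycle l i).
Definition list_order l i : nat := (find (pred1 i) (list_cycle l (perm_at l i))).+1.
Definition list_pow l k : seq nat := iter k (after l) list_id.

(** The type of an element of the stabilizer of a face, by its action on the face. *)
Inductive holonomy := Trivial | Rotation | Reflection.

(** In a dihedral group of order 10, the reflections are the elements of order 2,
    and the nontrivial rotations have order 5.  The classification is meaningful
    only for elements that stabilize a face. *)
Definition holonomy_of (l : seq nat) : holonomy :=
  if l == list_id then Trivial
  else if after l l == list_id then Reflection else Rotation.

Definition holonomies l : seq holonomy :=
  [seq holonomy_of (list_pow l (list_order l i)) | i <- iota 0 12 & list_root l i == i].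

Definition is_trivial h := if h is Trivial then true else false.
Definition is_rotation h := if h is Rotation then true else false.
Definition is_reflection h := if h is Reflection then true else false.

(** The exponents of t_id, t_r and t_f in the number of tilings fixed by l. *)
Definition profile l : seq nat :=
  [seq count p (holonomies l) | p <- [:: is_trivial; is_rotation; is_reflection]].

(** The blocks are the conjugacy classes of the rotations by their orders 1, 5, 3
    and 2, followed by their products with the central inversion; the two classes
    of elements of order 5 are in one block, and likewise those of order 10. *)
Lemma face_perms_profiles : perm_eq [seq profile l | l <- face_perms]
  ([:: [:: 12; 0; 0]] ++ nseq 24 [:: 2; 2; 0] ++ nseq 20 [:: 4; 0; 0]
   ++ nseq 15 [:: 6; 0; 0] ++ [:: [:: 6; 0; 0]] ++ nseq 24 [:: 1; 1; 0]
   ++ nseq 20 [:: 2; 0; 0] ++ nseq 15 [:: 4; 0; 4])%N.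
Proof. by vm_compute. Qed.

Lemma list_rootP (i : 'I_12) l : l \in face_perms ->
  list_root l (perm_at l i) = list_root l i /\ (val i \in list_cycle l (list_root l i)).
Proof.
have /allP roots : all (fun l => all (fun i =>
    (list_root l (perm_at l i) == list_root l i) && (i \in list_cycle l (list_root l i)))
  (iota 0 12)) face_perms by vm_compute.
by move=> /roots/all_iotaP/(_ i)/andP[/eqP].
Qed.

Definition base_symmetry (p : holonomy -> bool) : seq nat :=
  nth [::] face_perms
    (find (fun l => (perm_at l 0 == 0%N) && p (holonomy_of l)) face_perms).

Definition rotation0 : seq nat := Eval vm_compute in base_symmetry is_rotation.
Definition reflection0 : seq nat := Eval vm_compute in base_symmetry is_reflection.

Definition base_generator h : seq nat :=
  match h with Trivial => list_id | Rotation => rotation0 | Reflection => reflection0 end.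

(** The conjugate of s by g and the element l are powers of each other; exponents
    below 5 suffice because both elements have order 1, 2 or 5. *)
Definition conjugating (l s g : seq nat) : bool :=
  has (fun a => after (list_pow l a) g == after g s) [:: 1; 2; 3; 4]%N
  && has (fun b => after l g == after g (list_pow s b)) [:: 1; 2; 3; 4]%N.

Definition conjugate_to_base (l : seq nat) i : bool :=
  has (fun g => if perm_at g 0 == i then conjugating l (base_generator (holonomy_of l)) g
                else false) face_perms.

(** The five-fold rotations about a face form two conjugacy classes, by the angles
    72 and 144 degrees, so a nontrivial rotation need not be conjugate to
    [rotation0] itself; it is conjugate to a power of it. *)
Lemma stabilizer_conjugate l (i : 'I_12) : l \in face_perms -> perm_at l i = i ->
  conjugate_to_base l i.
Proof.
have /allP conj : all (fun l => all (fun i =>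
    if perm_at l i == i then conjugate_to_base l i else true)
  (iota 0 12)) face_perms by vm_compute.
by move=> /conj/all_iotaP/(_ i) + li; rewrite li eqxx.
Qed.

Definition monomial (a b c : nat) (p : seq nat) : nat :=
  (a ^ nth 0 p 0 * b ^ nth 0 p 1 * c ^ nth 0 p 2)%N.

Definition holonomy_weight (a b c : nat) (h : holonomy) : nat :=
  match h with Trivial => a | Rotation => b | Reflection => c end.

Lemma prod_holonomy_weight a b c l :
  (\prod_(h <- holonomies l) holonomy_weight a b c h)%N = monomial a b c (profile l).
Proof.
rewrite /profile; elim: (holonomies l) => [|h s IHs].
  by rewrite big_nil /monomial /= !expn0.
rewrite big_cons IHs /monomial /= !expnD.
by case: h; rewrite /= !(expn0, expn1, mul1n, muln1) -!mulnA //;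
  rewrite mulnCA //; congr (_ * _)%N; rewrite mulnCA.
Qed.

Lemma sum_monomials a b c : (\sum_(l <- face_perms) monomial a b c (profile l) =
  a ^ 12 + 24 * (a ^ 2 * b ^ 2) + 20 * a ^ 4 + 15 * a ^ 6 + a ^ 6 + 24 * (b * a)
  + 20 * a ^ 2 + 15 * (a ^ 4 * c ^ 4))%N.
Proof.
transitivity (\sum_(p <- [seq profile l | l <- face_perms]) monomial a b c p)%N.
  by rewrite big_map.
have m x y z : monomial a b c [:: x; y; z] = (a ^ x * b ^ y * c ^ z)%N by [].
rewrite (perm_big _ face_perms_profiles) !big_cat !big_nseq !big_seq1 !iter_addn_0 !m [LHS]/=.
rewrite !(expn0, expn1, muln1) (mulnC b a) !(mulnC _ 24) !(mulnC _ 20) !(mulnC _ 15).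
by rewrite -!addnA.
Qed.

(** * The dodecahedron and its symmetry group *)

Section Dodecahedron.
Variable R : realType.
Local Notation "u .[R]" := (zvec_val R u) (at level 2, format "u .[R]").
Local Notation P := (dodecahedron R).

(** Coefficients are plain scalars here, instead of bundled elements of the unit
    interval. *)
Lemma convex_setP (K : set 'cV[R]_3) :
  convex_set K <-> forall x y (a b : R), 0 <= a -> 0 <= b -> a + b = 1 ->
    K x -> K y -> K (a *: x + b *: y).
Proof.
split=> [K_convex x y a b a0 b0 ab Kx Ky | K_comb x y l].
  have a1 : a <= 1 by rewrite -ab lerDl.
  have a01 : Itv.spec (@Itv.num_sem R) (Itv.Real `[0%Z, 1%Z]) a.
    by rewrite /= /Itv.num_sem /= num_real in_itv /= a0 a1.
  have := K_convex x y (Itv.mk a01); rewrite !inE => /(_ Kx Ky).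
  congr K; congr (_ + _ *: _).
  by rewrite /= /unstable.onem -ab addrAC subrr add0r.
rewrite !inE => Kx Ky; apply: K_comb; rewrite ?unstable.onem_ge0 //.
by rewrite /unstable.onem addrC subrK.
Qed.

Definition normal (i : 'I_12) : 'cV[R]_3 := (znormal i).[R].
Definition vertex (j : 'I_20) : 'cV[R]_3 := (zvertex j).[R].
Definition height : R := zphi_val R zheight.
Definition gen (k : 'I_3) : 'M[R]_3 := nth 1 [:: R0 R; R1 R; R2 R] k.

Lemma zvertexP u : u \in zvertices -> exists j, u.[R] = vertex j.
Proof.
move=> uV; have ltu : (index u zvertices < 20)%N by rewrite -index_mem in uV.
by exists (Ordinal ltu); rewrite /vertex /zvertex nth_index.
Qed.

Lemma znormalP u : u \in znormals -> exists i, u.[R] = normal i.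
Proof.
move=> uN; have ltu : (index u znormals < 12)%N by rewrite -index_mem in uN.
by exists (Ordinal ltu); rewrite /normal /znormal nth_index.
Qed.

Lemma zphi_val1 : zphi_val R z1 = 1.
Proof. by rewrite /zphi_val /= mul0r addr0. Qed.

Lemma zphi_val0 : zphi_val R z0 = 0.
Proof. by rewrite /zphi_val /= mul0r addr0. Qed.

Lemma zphi_val_gold : zphi_val R zgold = golden_ratio R.
Proof. by rewrite /zphi_val /= add0r; apply: mul1r. Qed.

Lemma zphi_val2 : zphi_val R z2 = 2.
Proof. by rewrite zaddE zphi_val1. Qed.

Lemma zapplyE (k : 'I_3) u : (zapply (zgen k) u).[R] = 2 *: (gen k *m u.[R]).
Proof.
by elim/ord3_ind: k; apply: colP3; rewrite !mxE sum3E !mxE /=;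
  rewrite !(zaddE, zmulE, zsubE, zoppE) ?(zphi_val0, zphi_val1, zphi_val2, zphi_val_gold); field.
Qed.

Lemma zapply_eq_scale (k : 'I_3) u v :
  zapply (zgen k) u = zscale z2 v -> gen k *m u.[R] = v.[R].
Proof.
move=> /(congr1 (zvec_val R)); rewrite zapplyE zscaleE zphi_val2 => /scalerI; apply.
by rewrite pnatr_eq0.
Qed.

Lemma gen_vertex k j : gen k *m vertex j = vertex (Ordinal (vertex_tableP k j).2).
Proof. exact/zapply_eq_scale/(vertex_tableP k j).1. Qed.

Definition gen_face (k : 'I_3) (i : 'I_12) : 'I_12 :=
  let: And3 _ j_lt _ := face_tableP k i in Ordinal j_lt.

Lemma gen_faceE k i : val (gen_face k i) = perm_at (face_table k) i.
Proof. by rewrite /gen_face; case: face_tableP. Qed.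

Lemma gen_faceK k : involutive (gen_face k).
Proof.
move=> i; apply: val_inj; rewrite gen_faceE /perm_at gen_faceE.
by case: (face_tableP k i).
Qed.

Lemma gen_normal k i : gen k *m normal i = normal (gen_face k i).
Proof.
rewrite /normal gen_faceE; apply: zapply_eq_scale.
by case: (face_tableP k i).
Qed.

(** The matrices of the generators are symmetric, being orthogonal reflections. *)
Lemma gen_sym k u v : dot (gen k *m u) v = dot u (gen k *m v).
Proof.
rewrite /dot trmx_mul -mulmxA; congr ((_ *m (_ *m _)) 0 0).
apply/matrixP; elim/ord3_ind: k => i j.
all: by elim/ord3_ind: i; elim/ord3_ind: j; rewrite !mxE.
Qed.

(** Three of the normals are linearly independent.  Consequently relations between
    the generators may be verified on the permutations of the normals. *)
Lemma normal_mx_inj (A B : 'M[R]_3) :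
  (forall i, A *m normal i = B *m normal i) -> A = B.
Proof.
move=> AB; have [u [v [w [[uN vN wN] /(@zposP R)]]]] := normal_basisP; rewrite zdetE => D.
have [[a ua] [b vb] [c wc]] := And3 (znormalP uN) (znormalP vN) (znormalP wN).
by apply: (mx3_eq_on_basis (lt0r_neq0 D)); rewrite ?ua ?vb ?wc AB.
Qed.

Lemma gen_sqr k : gen k *m gen k = 1%:M.
Proof.
apply: normal_mx_inj => i.
by rewrite -mulmxA !gen_normal gen_faceK mul1mx.
Qed.

Implicit Types w : seq 'I_3.

Definition word_mx w : 'M[R]_3 := foldr (fun k A => gen k *m A) 1%:M w.

Definition gen_perm (k : 'I_3) : {perm 'I_12} := perm (inv_inj (@gen_faceK k)).

(** The rightmost letter of a word acts first as a matrix, and permutations are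
    multiplied in the order in which they are applied; hence the exchange of the
    factors. *)
Definition word_perm w : {perm 'I_12} := foldr (fun k s => (s * gen_perm k)%g) 1%g w.

Lemma word_mx_cat w1 w2 : word_mx (w1 ++ w2) = word_mx w1 *m word_mx w2.
Proof. by elim: w1 => [|k w1 IHw] /=; rewrite ?mul1mx // IHw mulmxA. Qed.

Lemma word_perm_cat w1 w2 : word_perm (w1 ++ w2) = (word_perm w2 * word_perm w1)%g.
Proof. by elim: w1 => [|k w1 IHw] /=; rewrite ?mulg1 // IHw mulgA. Qed.

Lemma word_mx_rev w : word_mx w *m word_mx (rev w) = 1%:M.
Proof.
elim: w => [|k w IHw] /=; first by rewrite mulmx1.
by rewrite rev_cons -cats1 word_mx_cat /= mulmx1 mulmxA -(mulmxA (gen k)) IHw mulmx1 gen_sqr.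
Qed.

Lemma word_mx_inv w : (word_mx w)^-1 = word_mx (rev w).
Proof.
have [AU _] := mulmx1_unit (word_mx_rev w).
by rewrite -[RHS](mulKr AU) -[X in _ = _ * X]/(word_mx w *m _) word_mx_rev mulr1.
Qed.

(** The generators are involutions, so the inverse of a word is the reversed word
    and no letters for inverses are needed. *)
Lemma Ih_words : Ih R = range word_mx.
Proof.
apply/seteqP; split.
  apply: smallest_sub; first split.
  - by exists [::].
  - by move=> _ _ [w1 _ <-] [w2 _ <-]; exists (w1 ++ w2); rewrite ?word_mx_cat.
  - by move=> _ [w _ <-]; exists (rev w); rewrite ?word_mx_inv.
  move=> _ [[->|->]|->].
  - by exists [:: 0] => //=; rewrite mulmx1.
  - by exists [:: 1] => //=; rewrite mulmx1.
  - by exists [:: 2] => //=; rewrite mulmx1.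
move=> _ [w _ <-] H [[H1 HM _] genH]; elim: w => //= k w IHw.
by apply: HM => //; apply: genH; elim/ord3_ind: k; [left; left | left; right | right].
Qed.

Lemma word_mx_normal w i : word_mx w *m normal i = normal (word_perm w i).
Proof.
elim: w => [|k w IHw] /=; first by rewrite mul1mx perm1.
by rewrite -mulmxA IHw gen_normal permM permE.
Qed.

Lemma word_mx_eq w1 w2 : word_perm w1 = word_perm w2 -> word_mx w1 = word_mx w2.
Proof.
by move=> eqw; apply: normal_mx_inj => i; rewrite !word_mx_normal eqw.
Qed.

Lemma word_mx_vertex w j : exists j', word_mx w *m vertex j = vertex j'.
Proof.
elim: w => [|k w [j' IHw]] /=; first by exists j; rewrite mul1mx.
by rewrite -mulmxA IHw gen_vertex; eexists.
Qed.

Lemma vertex0 : vertex 0 = const_mx 1.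
Proof. by apply: colP3; rewrite !mxE /= zphi_val1. Qed.

(** The vertices of the dodecahedron are defined as an orbit; that all 20 listed
    points occur is read off the computed orbit of the index 0. *)
Lemma vertex_orbit j : exists w, vertex j = word_mx w *m vertex 0.
Proof.
have : exists (j' : 'I_20) w, val j' = val j /\ vertex j' = word_mx w *m vertex 0.
  have := vertices_reachedP j; move: (val j).
  apply: (closure_ind (P := fun m => exists (j' : 'I_20) w,
    val j' = m /\ vertex j' = word_mx w *m vertex 0)).
    by move=> _ /[1!inE] /eqP->; exists 0, [::]; rewrite mul1mx.
  move=> k _ k3 [j1 [w [<- jw]]].
  by exists (Ordinal (vertex_tableP (Ordinal k3) j1).2), (Ordinal k3 :: w);
    rewrite -gen_vertex jw mulmxA.
by case=> j' [w [/val_inj -> ->]]; exists w.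
Qed.

Lemma dodecahedronE : P = convex_hull (range vertex).
Proof.
congr convex_hull; rewrite Ih_words; apply/seteqP; split.
  move=> _ [_ [w _ <-] <-]; rewrite -vertex0.
  by have [j ->] := word_mx_vertex w 0; exists j.
move=> _ [j _ <-]; have [w ->] := vertex_orbit j.
by exists (word_mx w); [exists w | rewrite vertex0].
Qed.

Lemma vertex_in j : P (vertex j).
Proof. by rewrite dodecahedronE; apply: sub_gen_smallest; exists j. Qed.

Lemma dodecahedron_sub (K : set 'cV[R]_3) :
  convex_set K -> (forall j, K (vertex j)) -> P `<=` K.
Proof.
move=> K_convex KV; rewrite dodecahedronE.
by apply: smallest_sub => // _ [j _ <-].
Qed.

Lemma gen_dodecahedron k x : P x -> P (gen k *m x).
Proof.
move=> Px; rewrite dodecahedronE => K [/convex_setP K_comb KV].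
suff : P `<=` [set y | K (gen k *m y)] by apply.
apply: dodecahedron_sub => [|j]; last by rewrite /= gen_vertex; apply: KV; eexists.
apply/convex_setP=> y z a b a0 b0 ab Ky Kz /=.
by rewrite mulmxDr -!scalemxAr; apply: K_comb.
Qed.

Lemma halfspace_convex (n : 'cV[R]_3) c : convex_set [set x | dot n x <= c].
Proof.
apply/convex_setP=> x y a b a0 b0 ab /= nx ny; rewrite dotDr !dotZr.
by rewrite -[c]mul1r -ab mulrDl lerD // ler_wpM2l.
Qed.

Lemma normal_le i x : P x -> dot (normal i) x <= height.
Proof.
suff : P `<=` [set x | dot (normal i) x <= height] by apply.
apply: dodecahedron_sub => [|j /=]; first exact: halfspace_convex.
rewrite -subr_ge0 -zdotE -zsubE.
have := zvertex_le i j; case/orP=> [/(@zzeroP R) -> //|/(@zposP R)/ltW //].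
Qed.

Definition face i : set 'cV[R]_3 := [set x | P x /\ dot (normal i) x = height].

Lemma gen_face_sub k i x : face i x -> face (gen_face k i) (gen k *m x).
Proof.
move=> [Px nx]; split; first exact: gen_dodecahedron.
by rewrite -gen_normal gen_sym mulmxA gen_sqr mul1mx.
Qed.

Lemma word_mx_face w i : mx_image (word_mx w) (face i) = face (word_perm w i).
Proof.
elim: w => [|k w IHw] /=.
  rewrite perm1; apply/seteqP; split=> [_ [x Fx <-]|x Fx]; first by rewrite mul1mx.
  by exists x; rewrite ?mul1mx.
rewrite permM permE; apply/seteqP; split=> [_ [x Fx <-]|y Fy].
  by rewrite -mulmxA; apply: gen_face_sub; rewrite -IHw; exists x.
have := gen_face_sub k Fy; rewrite gen_faceK -IHw => -[x Fx xy].
by exists x => //; rewrite -mulmxA xy mulmxA gen_sqr mul1mx.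
Qed.

Lemma on_face_vertex (i : 'I_12) u : u \in zvertices -> on_face i u -> face i u.[R].
Proof.
move=> uV u_on; split; first by have [j ->] := zvertexP uV; apply: vertex_in.
by apply/esym/eqP; rewrite -subr_eq0 -zdotE -zsubE zzeroP.
Qed.

Lemma face_inj : injective face.
Proof.
move=> i j Fij; apply/eqP; apply: contraT => /face_sepP[u uV /andP[u_i /(@zposP R)]].
rewrite zsubE zdotE subr_gt0.
by have := on_face_vertex uV u_i; rewrite Fij => -[_ ->]; rewrite ltxx.
Qed.

Lemma face_basis i : exists x y z,
  [/\ face i x, face i y, face i z & det3 x y z != 0].
Proof.
have [u [v [w [[uV vV wV] [ui vi wi] /(@zposP R)]]]] := face_basisP i.
rewrite zdetE => /lt0r_neq0 D; exists u.[R], v.[R], w.[R].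
by split=> //; apply: on_face_vertex.
Qed.

Lemma height_gt0 : 0 < height.
Proof. exact: zposP. Qed.

Lemma normal_neq0 i : normal i != 0.
Proof.
apply/eqP => n0; have [x [_ [_ [[_ nx] _ _ _]]]] := face_basis i.
by have := height_gt0; rewrite -nx n0 /dot trmx0 mul0mx mxE ltxx.
Qed.

Lemma face_in_faces i : faces P (face i).
Proof.
split; first by exists (normal i), height; split=> //; [apply: normal_neq0 | apply: normal_le].
have [x [y [z [Fx Fy Fz D]]]] := face_basis i; exists x, y, z; split=> //.
apply: cross_free; rewrite cross_subE; apply: contraNneq D => cr0.
have := det3_plane Fx.2 Fy.2 Fz.2; rewrite cr0 scaler0 => /eqP.
by rewrite scaler_eq0 (negbTE (normal_neq0 i)) orbF.
Qed.

(** In a convex combination of points of the half-space n . x <= c which lies on its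
    boundary, every point of nonzero weight is on the boundary.  So the points of
    the half-space such that u vanishes if they are on the boundary form a convex
    set, and it contains the dodecahedron as soon as it contains the vertices. *)
Lemma exposed_face_linear (n u : 'cV[R]_3) c :
    (forall x, P x -> dot n x <= c) ->
    (forall j, dot n (vertex j) = c -> dot u (vertex j) = 0) ->
  forall x, P x -> dot n x = c -> dot u x = 0.
Proof.
move=> n_le uV x Px nx.
suff : P `<=` [set x | dot n x <= c /\ (dot n x = c -> dot u x = 0)].
  by case/(_ x Px) => _; apply.
apply: dodecahedron_sub => [|j]; last first.
  by split; [apply: n_le; apply: vertex_in | exact: uV].
apply/convex_setP=> y z a b a0 b0 ab [ny uy] [nz uz].
have /convex_setP/(_ y z a b a0 b0 ab ny nz) /= le_c := halfspace_convex (n := n) (c := c).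
split; first exact: le_c.
rewrite !dotDr !dotZr => nyz.
have : a * (c - dot n y) + b * (c - dot n z) = 0.
  by rewrite !mulrBr addrACA -mulrDl ab mul1r -opprD nyz subrr.
have yc : 0 <= c - dot n y by rewrite subr_ge0.
have zc : 0 <= c - dot n z by rewrite subr_ge0.
move/eqP; rewrite paddr_eq0 ?mulr_ge0 // !mulf_eq0 !subr_eq0.
have or_eq0 a' y' : (a' == 0) || (c == dot n y') -> (dot n y' = c -> dot u y' = 0) ->
    a' * dot u y' = 0.
  by case/orP => /eqP; [move=> -> _; rewrite mul0r | move=> cy ->; rewrite ?mulr0].
by case/andP=> /or_eq0/(_ uy) -> /or_eq0/(_ uz) ->; rewrite addr0.
Qed.

(** The determinant is linear in each argument, so [exposed_face_linear] permits
    to replace x, y and z by vertices on the same plane one after the other. *)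
Lemma exposed_face_vertices (n : 'cV[R]_3) c x y z :
    (forall x, P x -> dot n x <= c) -> P x -> P y -> P z ->
    dot n x = c -> dot n y = c -> dot n z = c -> det3 x y z != 0 ->
  exists i j k, [/\ dot n (vertex i) = c, dot n (vertex j) = c, dot n (vertex k) = c
    & det3 (vertex i) (vertex j) (vertex k) != 0].
Proof.
move=> n_le Px Py Pz nx ny nz D; apply: contrapT => none; case/eqP: D.
have ext := exposed_face_linear n_le.
have det3E p q r : det3 p q r = dot (cross q r) p by rewrite /det3 dotC.
have D0 i j k : dot n (vertex i) = c -> dot n (vertex j) = c ->
    dot n (vertex k) = c -> det3 (vertex i) (vertex j) (vertex k) = 0.
  move=> ni nj nk; apply: contrapT => /eqP D; apply: none.
  by exists i, j, k.
have D1 j k : dot n (vertex j) = c -> dot n (vertex k) = c ->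
    det3 x (vertex j) (vertex k) = 0.
  by move=> nj nk; rewrite det3E; apply: ext => // i ni; rewrite -det3E D0.
have D2 k : dot n (vertex k) = c -> det3 y (vertex k) x = 0.
  move=> nk; rewrite det3E; apply: ext => // j nj.
  by rewrite -det3E -det3_cycle D1.
rewrite -det3_cycle det3E; apply: ext => // k nk.
by rewrite -det3E 2!det3_cycle D2.
Qed.

(** The vertex set is symmetric about the origin and spans the space. *)
Lemma exposed_height_gt0 (n : 'cV[R]_3) c : n != 0 ->
  (forall x, P x -> dot n x <= c) -> 0 < c.
Proof.
move=> n0 n_le.
have opp_vertex j : dot n (vertex j) + c >= 0.
  have /zvertex_opp/zvertexP[j' jj'] : zvertex j \in zvertices.
    by rewrite mem_nth.
  have oppE : - vertex j = vertex j' by rewrite -jj' zscaleE zoppE zphi_val1 scaleN1r.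
  rewrite -[dot _ _]opprK -dotNr oppE addrC subr_ge0.
  by apply: n_le; apply: vertex_in.
have vertex_opp j : dot n (vertex j) <= c by apply: n_le; apply: vertex_in.
have c0 : 0 <= c by have := opp_vertex 0; have := vertex_opp 0; lra.
rewrite lt_neqAle c0 andbT; apply/eqP => c_eq0.
have nv u : u \in zvertices -> dot n u.[R] = 0.
  case/zvertexP=> j ->; apply/eqP; rewrite eq_le.
  by have := opp_vertex j; have := vertex_opp j; rewrite -c_eq0 addr0 => -> ->.
have [u [v [w [[uV vV wV] _ /(@zposP R)]]]] := face_basisP 0.
rewrite zdetE => /lt0r_neq0 D.
have := det3_plane (nv u uV) (nv v vV) (nv w wV).
by move/eqP; rewrite scale0r scaler_eq0 (negbTE D) (negbTE n0).
Qed.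

(** The plane through three vertices has the equation N . x = D; a vertex beyond it
    would violate n_le, so by [facet_testP] it is a face plane. *)
Lemma vertex_facet (n : 'cV[R]_3) c i j k : n != 0 ->
    (forall x, P x -> dot n x <= c) ->
    dot n (vertex i) = c -> dot n (vertex j) = c -> dot n (vertex k) = c ->
    det3 (vertex i) (vertex j) (vertex k) != 0 ->
  exists m, height *: n = c *: normal m.
Proof.
move=> n0 n_le ni nj nk D0.
have c0 := exposed_height_gt0 n0 n_le.
have inV (l : 'I_20) : zvertex l \in zvertices by rewrite mem_nth.
have := facet_testP (inV i) (inV j) (inV k); rewrite /facet_test.
case: ifP => [/(@zzeroP R)|_]; first by rewrite zdetE => /eqP; rewrite (negbTE D0).
have nD := det3_plane ni nj nk.
set N := zvec_add _ _; set D := zdet _ _ _.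
have NE : N.[R] = cross (vertex j) (vertex k) + cross (vertex k) (vertex i)
    + cross (vertex i) (vertex j) by rewrite !zvec_addE !zcrossE.
rewrite -NE in nD.
have DE : zphi_val R D = det3 (vertex i) (vertex j) (vertex k) by rewrite zdetE.
rewrite -DE in nD D0.
case: ifP => [/hasP[x xV /(@zposP R)] | _ /hasP[m mN /eqP mE]].
  rewrite zmulE zsubE zdotE => gt0 _; exfalso.
  have [l xl] := zvertexP xV; have := n_le _ (vertex_in l); rewrite -xl.
  have := congr1 (fun y => dot y x.[R]) nD; rewrite /= !dotZl => nDx.
  set d := zphi_val R D in D0 gt0 nDx; set q := dot N.[R] _ in gt0 nDx.
  move=> nx.
  have : d * (d * dot n x.[R]) <= d * (d * c).
    by rewrite !mulrA ler_wpM2l // -expr2 sqr_ge0.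
  rewrite nDx leNgt; case/negP.
  have : 0 < c * (d * (q - d)) by rewrite mulr_gt0.
  by move=> pos; rewrite -subr_gt0; move: pos; congr (0 < _); ring.
have [m' mm'] := znormalP mN; exists m'.
have := congr1 (zvec_val R) mE; rewrite !zscaleE mm' -/height => hN.
apply/(scalerI D0); rewrite scalerA mulrC -scalerA nD scalerA mulrC -scalerA hN.
by rewrite !scalerA mulrC.
Qed.

Lemma facesP (F : set 'cV[R]_3) : faces P F -> exists i, F = face i.
Proof.
move=> [[n [c [n0 n_le ->]]] [x [y [z [[Px nx] [Py ny] [Pz nz] /free_cross]]]]].
have c0 := exposed_height_gt0 n0 n_le.
rewrite cross_subE => cr0.
have D : det3 x y z != 0.
  apply: contraNneq cr0 => D; have := det3_plane nx ny nz.
  by move/esym/eqP; rewrite D scale0r scaler_eq0 gt_eqF.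
have [i [j [k [ni nj nk D']]]] := exposed_face_vertices n_le Px Py Pz nx ny nz D.
have [m hm] := vertex_facet n0 n_le ni nj nk D'; exists m.
have hmx u : height * dot n u = c * dot (normal m) u by rewrite -!dotZl hm.
apply/seteqP; split=> u [Pu]; have := hmx u.
  move=> + nu; rewrite nu mulrC => /(mulfI (lt0r_neq0 c0)) E; by split.
by move=> + nu; rewrite nu [RHS]mulrC => /(mulfI (lt0r_neq0 height_gt0)) E; split.
Qed.

Lemma face_mx_inj i (A B : 'M[R]_3) :
  (forall x, face i x -> A *m x = B *m x) -> A = B.
Proof.
move=> AB; have [x [y [z [Fx Fy Fz D]]]] := face_basis i.
by apply: (mx3_eq_on_basis D); apply: AB.
Qed.

(** Used with p + a u the fixed line of an isometry of the face plane. *)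
Lemma face_not_line i p (u : 'cV[R]_3) : ~ (forall x, face i x -> exists a : R, x = p + a *: u).
Proof.
move=> F_line; have [_ [x [y [z [Fx Fy Fz /free_cross]]]]] := face_in_faces i.
have [[a ->] [b ->] [c ->]] := And3 (F_line x Fx) (F_line y Fy) (F_line z Fz).
by case/eqP; apply: colP3; rewrite !mxE /=; ring.
Qed.

Lemma frame_coords (u v p : 'cV[R]_3) (a b a' b' : R) :
    dot u u = 1 -> dot v v = 1 -> dot u v = 0 ->
  p + a *: u + b *: v = p + a' *: u + b' *: v -> a = a' /\ b = b'.
Proof.
move=> uu vv uv; rewrite -!addrA => /addrI eq_ab.
have [du dv] := (congr1 (dot u) eq_ab, congr1 (dot v) eq_ab).
rewrite !dotDr !dotZr uu vv uv (dotC v u) uv in du dv.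
by split; [move: du | move: dv]; rewrite !(mulr1, mulr0, addr0, add0r).
Qed.

(** If A * A = 1 then the rotation by twice the angle fixes every point of the
    face; as sin (2 pi / 5) != 0, the face is then contained in the line b = 0. *)
Lemma rotation_sqr_neq1 i (A : 'M[R]_3) : mx_image A (face i) = face i ->
  rotates_face (2 * pi / 5) A (face i) -> A *m A <> 1%:M.
Proof.
move=> AF [p [u [v [[uu vv uv F_plane] A_rot]]]] AA.
set theta := 2 * pi / 5 in A_rot.
have s_neq0 : sin theta != 0.
  by apply/lt0r_neq0/sin_gt0_pi; rewrite /theta; have := pi_gt0 R; lra.
apply: (@face_not_line i p u) => x Fx; have [a [b xE]] := F_plane x Fx.
have Ax := A_rot a b; rewrite -xE in Ax; have {}Ax := Ax Fx.
have FAx : face i (A *m x) by rewrite -AF; exists x.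
move: (Ax) (FAx); set a' := a * _ - _; set b' := a * _ + _ => -> /A_rot.
rewrite -Ax mulmxA AA mul1mx xE => /(frame_coords uu vv uv).
rewrite /a' /b'; have := sin2cos2 theta; move: s_neq0.
set s := sin theta; set c := cos theta; rewrite !expr2 => s_neq0 cs1 [ea eb].
have [ca cb] := (congr1 ( *%R a) cs1, congr1 ( *%R b) cs1).
have /(mulfI s_neq0) e1 : s * (s * a + c * b) = s * 0 by lra.
have /(mulfI s_neq0) e2 : s * (c * a - s * b) = s * 0 by lra.
have b0 : b = 0.
  have [f1 f2] := (congr1 ( *%R c) e1, congr1 ( *%R s) e2); lra.
by exists a; rewrite b0 scale0r addr0.
Qed.

(** The square fixes the face pointwise, and a face spans the space as its plane
    does not contain the origin; if A were the identity, the face would lie on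
    the mirror line. *)
Lemma reflection_order i (A : 'M[R]_3) : mx_image A (face i) = face i ->
  reflects_face A (face i) -> A *m A = 1%:M /\ A <> 1%:M.
Proof.
move=> AF [p [u [v [[uu vv uv F_plane] A_refl]]]]; split.
  apply: (@face_mx_inj i) => x Fx; rewrite mul1mx -mulmxA.
  have [a [b xE]] := F_plane x Fx.
  have Ax := A_refl a b; rewrite -xE in Ax; have {}Ax := Ax Fx.
  have FAx : face i (A *m x) by rewrite -AF; exists x.
  rewrite Ax -scaleNr in FAx *.
  by rewrite A_refl // scaleNr opprK.
move=> A1; apply: (@face_not_line i p u) => x Fx; have [a [b xE]] := F_plane x Fx.
exists a; have := A_refl a b; rewrite -xE => /(_ Fx); rewrite A1 mul1mx xE -scaleNr.
move=> /(frame_coords uu vv uv) [_ b_opp].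
have -> : b = 0 by lra.
by rewrite scale0r addr0.
Qed.

End Dodecahedron.

(** * The group of face permutations *)

Section PermutationCodes.
Implicit Types g h : {perm 'I_12}.

Definition perm_code g : seq nat := [seq val (g i) | i <- enum 'I_12].

Lemma perm_at_code g (i : 'I_12) : perm_at (perm_code g) i = val (g i).
Proof. by rewrite /perm_at (nth_map i) ?size_enum_ord // nth_ord_enum. Qed.

Lemma perm_code_inj : injective perm_code.
Proof.
by move=> g h eq_gh; apply/permP=> i; apply: val_inj; rewrite -!perm_at_code eq_gh.
Qed.

Lemma perm_codeM g h : perm_code (g * h)%g = after (perm_code h) (perm_code g).
Proof.
rewrite /after /perm_code -map_comp; apply: eq_map => i /=.
by rewrite perm_at_code permM.
Qed.

Lemma perm_code_gen g k :
  perm_code (g * gen_perm k)%g = after (face_table k) (perm_code g).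
Proof.
rewrite /after /perm_code -map_comp; apply: eq_map => i /=.
by rewrite permM permE gen_faceE.
Qed.

Lemma perm_code1 : perm_code 1%g = list_id.
Proof. by rewrite -[RHS]val_enum_ord; apply: eq_map => i; rewrite perm1. Qed.

Lemma perm_codeX g k : perm_code (g ^+ k)%g = list_pow (perm_code g) k.
Proof.
elim: k => [|k IHk]; first exact: perm_code1.
by rewrite expgSr perm_codeM IHk.
Qed.

Lemma iter_perm_at_code g k (i : 'I_12) : iter k (perm_at (perm_code g)) i = iter k g i.
Proof. by elim: k => //= k ->; rewrite perm_at_code. Qed.

Lemma list_order_code g (i : 'I_12) : list_order (perm_code g) i = fingraph.order g i.
Proof.
have g_inj : injective g by apply: perm_inj.
rewrite /list_order /list_cycle perm_at_code.
set s := traject _ _ _; set m := (fingraph.order g i).-1.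
have om : fingraph.order g i = m.+1 by rewrite /m orderSpred.
have m12 : (m < 12)%N by rewrite -om; have := max_card (fconnect g i); rewrite card_ord.
have s_nth k : (k < 12)%N -> nth 0%N s k = iter k.+1 g i.
  move=> k12; rewrite /s (set_nth_default (val (g i))) ?size_traject //.
    by rewrite nth_traject // iter_perm_at_code -iterSr.
rewrite om; congr _.+1; apply/eqP; rewrite eqn_leq; apply/andP; split.
  rewrite leqNgt; apply/negP => /(before_find 0%N) /=.
  by rewrite s_nth // -om iter_order ?eqxx.
have s_has : has (pred1 (val i)) s.
  apply/(has_nthP 0%N); exists m; first by rewrite size_traject.
  by rewrite /= s_nth // -om iter_order.
rewrite leqNgt; apply/negP => find_m.
have := nth_find 0%N s_has; rewrite /= s_nth ?(ltn_trans find_m) //.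
move=> /eqP/val_inj ret; have := findex_iter (f := g) (x := i) (i := (find (pred1 (val i)) s).+1).
by rewrite om ltnS => /(_ find_m); rewrite ret findex0.
Qed.

Lemma list_root_lt l (i : 'I_12) : (list_root l i < 12)%N.
Proof.
rewrite /list_root; elim: (list_cycle l i) => //= j s IHs.
by rewrite (leq_ltn_trans (geq_minr _ _)).
Qed.

Lemma holonomy_of_code g :
  holonomy_of (perm_code g) =
    if g == 1%g then Trivial else if (g * g)%g == 1%g then Reflection else Rotation.
Proof. by rewrite /holonomy_of -perm_codeM -perm_code1 !(inj_eq perm_code_inj). Qed.

End PermutationCodes.

Section Group.
Variable R : realType.

(** The set of the words' permutations is closed under inverses because it is
    finite, so closure under products is enough. *)
Definition face_group_set : {set {perm 'I_12}} :=
  [set g | `[< exists w, word_perm w = g >]]%SET.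

Lemma face_group_setP g : reflect (exists w, word_perm w = g) (g \in face_group_set).
Proof. by rewrite inE; apply: asboolP. Qed.

Lemma face_group_group_set : group_set face_group_set.
Proof.
apply/group_setP; split; first by apply/face_group_setP; exists [::].
move=> _ _ /face_group_setP[w1 <-] /face_group_setP[w2 <-].
by apply/face_group_setP; exists (w2 ++ w1); rewrite word_perm_cat.
Qed.
Canonical face_group := Group face_group_group_set.

(** The group as a type of its own, so that its actions are total. *)
Definition sym : finGroupType := subg_of face_group.
Implicit Types u v : sym.

Definition sym_code u : seq nat := perm_code (sgval u).

Lemma sym_word_ex u : exists w, word_perm w = sgval u.
Proof. exact/face_group_setP/subgP. Qed.

(** The word of u is chosen arbitrarily; the matrix does not depend on the choice
    by [word_mx_eq]. *)
Definition sym_word u : seq 'I_3 := projT1 (cid (sym_word_ex u)).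

Lemma sym_wordP u : word_perm (sym_word u) = sgval u.
Proof. by rewrite /sym_word; case: cid. Qed.

Lemma word_sym w : exists u, sgval u = word_perm w.
Proof.
have wG : word_perm w \in face_group by apply/face_group_setP; exists w.
by exists (subg face_group (word_perm w)); rewrite subgK.
Qed.

Lemma sym_code_inj : injective sym_code.
Proof. by move=> u v /perm_code_inj/val_inj. Qed.

Lemma sym_codeM u v : sym_code (u * v)%g = after (sym_code v) (sym_code u).
Proof. exact: perm_codeM. Qed.

Lemma sgvalX u k : sgval (u ^+ k)%g = (sgval u ^+ k)%g.
Proof. by elim: k => // k IHk; rewrite !expgS /= -IHk. Qed.

Lemma sym_codeX u k : sym_code (u ^+ k)%g = list_pow (sym_code u) k.
Proof. by rewrite /sym_code sgvalX perm_codeX. Qed.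

Lemma sym_code_face_perms u : sym_code u \in face_perms.
Proof.
rewrite /sym_code -sym_wordP; elim: (sym_word u) => [|k w IHw] /=.
  by rewrite perm_code1 face_perms_id.
by rewrite perm_code_gen face_perms_closed.
Qed.

Lemma face_perms_code l : l \in face_perms -> exists u, sym_code u = l.
Proof.
rewrite face_permsE => lL.
suff [w <-] : exists w, perm_code (word_perm w) = l.
  by have [u <-] := word_sym w; exists u.
move: l lL; apply: closure_ind => [l|k l k3 [w <-]].
  by rewrite inE => /eqP ->; exists [::]; rewrite perm_code1.
by exists (Ordinal k3 :: w); rewrite /= perm_code_gen.
Qed.

Lemma codes_face_perms : perm_eq [seq sym_code u | u <- enum sym] face_perms.
Proof.
apply: uniq_perm; rewrite ?(map_inj_uniq sym_code_inj) ?enum_uniq ?face_perms_uniq //.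
move=> l; apply/mapP/idP => [[u _ ->]|/face_perms_code[u <-]]; first exact: sym_code_face_perms.
by exists u; rewrite ?mem_enum.
Qed.

Definition act_face (i : 'I_12) u : 'I_12 := sgval u i.

Lemma act_face_is_action : is_action [set: sym]%SET act_face.
Proof.
by apply: is_total_action => [i|i u v]; rewrite /act_face /= (perm1, permM).
Qed.
Canonical face_action := Action act_face_is_action.

Lemma sym_word_mx1 : word_mx R (sym_word 1%g) = 1%:M.
Proof. by rewrite (@word_mx_eq _ _ [::]) // sym_wordP. Qed.

Lemma sym_word_mxM u v :
  word_mx R (sym_word (u * v)%g) = word_mx R (sym_word v) * word_mx R (sym_word u).
Proof.
rewrite (@word_mx_eq _ _ (sym_word v ++ sym_word u)) ?word_mx_cat //.
by rewrite word_perm_cat !sym_wordP.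
Qed.

End Group.

(** * Tilings and their orbits *)

Section Designs.
Variables (R : realType) (T : finType).
Variable D : tile_designs (Ih R) (dodecahedron R) T.
Local Notation P := (dodecahedron R).
Implicit Types (u v : sym) (i : 'I_12) (t : T).

Definition facet i : faces P := SigSub (mem_set (face_in_faces R i)).

Lemma facet_inj : injective facet.
Proof. by move=> i j /(congr1 val)/(@face_inj R). Qed.

Lemma facet_ex (F : faces P) : exists i, F = facet i.
Proof.
have [i Fi] := facesP (set_valP F); exists i; exact: val_inj.
Qed.

Definition facet_index (F : faces P) : 'I_12 := projT1 (cid (facet_ex F)).

Lemma facet_indexK : cancel facet_index facet.
Proof. by move=> F; rewrite /facet_index; case: cid. Qed.

Lemma facetK : cancel facet facet_index.
Proof. by move=> i; apply: facet_inj; rewrite facet_indexK. Qed.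

Definition sym_mx u : 'M[R]_3 := word_mx R (sym_word u).

Lemma sym_mx_Ih u : Ih R (sym_mx u).
Proof. by rewrite Ih_words; exists (sym_word u). Qed.

Lemma Ih_sym_mx A : Ih R A -> exists u, A = sym_mx u.
Proof.
rewrite Ih_words => -[w _ <-]; have [u uw] := word_sym w; exists u.
by apply: word_mx_eq; rewrite sym_wordP.
Qed.

Lemma sym_mx_face u i : mx_image (sym_mx u) (face i) = face (act_face i u).
Proof. by rewrite word_mx_face sym_wordP. Qed.

(** Pairs with the index of a face, unlike pairs with a face, form a finite type,
    to which Burnside's lemma applies. *)
Definition act_design (x : T * 'I_12) u : T * 'I_12 :=
  ((tile_act D (sym_mx u) (x.1, facet x.2)).1, act_face x.2 u).

Lemma tile_actE u x :
  tile_act D (sym_mx u) (x.1, facet x.2) = ((act_design x u).1, facet (act_design x u).2).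
Proof.
rewrite [LHS]surjective_pairing; congr (_, _); apply: val_inj.
by rewrite tile_act_face /= ?sym_mx_face //; apply: sym_mx_Ih.
Qed.

Lemma act_design_is_action : is_action [set: sym]%SET act_design.
Proof.
apply: is_total_action => [[t i]|[t i] u v]; rewrite {1}/act_design /=.
  by rewrite /sym_mx sym_word_mx1 tile_act1 /= /act_face perm1.
rewrite [act_design (act_design _ _) _]/act_design -tile_actE.
rewrite {1}/sym_mx sym_word_mxM tile_actM; try exact: sym_mx_Ih.
by rewrite /act_face permM.
Qed.
Canonical design_action := Action act_design_is_action.

Lemma act_design_face x u : (design_action x u).2 = face_action x.2 u.
Proof. by []. Qed.

Local Notation tiling_action := (moved_action act_design_face).

Lemma mem_returning A u i t : A = sym_mx u -> act_face i u = i ->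
  (t \in fixed_designs D A (facet i)) = (t \in returning design_action u i).
Proof.
move=> -> ui; rewrite !inE (tile_actE u (t, i)) /= ui.
by rewrite /act_design !xpair_eqE /= ui !eqxx.
Qed.

(** All holonomies of the same type are compared with one element of the stabilizer
    of the face 0. *)
Lemma returning_base u i : act_face i u = i ->
  exists2 s, sym_code s = base_generator (holonomy_of (sym_code u)) &
    #|returning design_action u i| = #|returning design_action s 0|.
Proof.
move=> ui; set h := holonomy_of (sym_code u).
have /face_perms_code[s sE] : base_generator h \in face_perms.
  by case: h; vm_compute.
exists s => //.
have : conjugate_to_base (sym_code u) i.
  by apply: stabilizer_conjugate; rewrite ?sym_code_face_perms // perm_at_code [sgval u i]ui.
case/hasP=> l /face_perms_code[g <-].
case: eqP => // g0; rewrite -/h -sE.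
case/andP => /hasP[a _ /eqP +] /hasP[b _ /eqP +].
rewrite -!sym_codeX -!sym_codeM => /sym_code_inj ga /sym_code_inj gb.
have <- : act_face 0 g = i by apply: val_inj; rewrite -[RHS]g0 (perm_at_code (sgval g) 0).
have ua : (u ^+ a = s ^ g)%g by rewrite conjgE -ga mulKg.
have us : (u = (s ^+ b) ^ g)%g by rewrite conjgE -gb mulKg.
exact: (card_returning_cyclic act_design_face 0 ua us).
Qed.

Lemma returning_holonomy u i v j : act_face i u = i -> act_face j v = j ->
    holonomy_of (sym_code u) = holonomy_of (sym_code v) ->
  #|returning design_action u i| = #|returning design_action v j|.
Proof.
move=> /returning_base[s su ->] /returning_base[s' sv ->] uv.
by congr #|returning _ _ _|; apply: sym_code_inj; rewrite su sv uv.
Qed.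

(** Functions of the indices form a finite type, on which the orbits are counted. *)
Definition tiling_of (x : {ffun 'I_12 -> T}) : faces P -> T := fun F => x (facet_index F).

Lemma tiling_of_inj : injective tiling_of.
Proof.
move=> x y /(congr1 (fun h => h \o facet)) xy; apply/ffunP=> i.
by have := congr1 (fun h => h i) xy; rewrite /= /tiling_of facetK.
Qed.

Lemma tiling_of_surj tau : exists x, tiling_of x = tau.
Proof.
exists [ffun i => tau (facet i)]; apply/funext => F.
by rewrite /tiling_of ffunE facet_indexK.
Qed.

Lemma tiling_graph_inj (tau tau' : faces P -> T) :
  tiling_graph tau = tiling_graph tau' -> tau = tau'.
Proof.
move=> /seteqP[sub _]; apply/funext=> F; exact: (sub (tau F, F) erefl).
Qed.

Lemma tiling_graph_act u x :
  tile_act D (sym_mx u) @` tiling_graph (tiling_of x)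
    = tiling_graph (tiling_of (tiling_action x u)).
Proof.
have actE i : tile_act D (sym_mx u) (x i, facet i)
    = (tiling_action x u (act_face i u), facet (act_face i u)).
  rewrite (tile_actE u (x i, i)).
  by rewrite [act_design _ _](movedE act_design_face x u i).
apply/seteqP; rewrite /tiling_graph; split=> [_ [[t F] /= + <-] | [t F] /=] => ->.
  rewrite -(facet_indexK F) /tiling_of facetK actE.
  by rewrite /= facetK.
set i := act_face (facet_index F) u^-1%g.
exists (x i, facet i); first by rewrite /= /tiling_of facetK.
by rewrite actE /i [act_face (act_face _ _) _](actKV face_action) facet_indexK.
Qed.

Lemma tiling_orbitE x :
  tiling_orbit D (tiling_of x) = tiling_of @` [set` orbit tiling_action [set: sym]%SET x].
Proof.
apply/seteqP; split=> [tau [A /Ih_sym_mx[u ->]]|_ [_ /orbitP[u _ <-] <-]].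
  rewrite tiling_graph_act => /tiling_graph_inj ->.
  by exists (tiling_action x u) => //; apply/orbitP; exists u; rewrite ?inE.
by exists (sym_mx u); [apply: sym_mx_Ih | rewrite tiling_graph_act].
Qed.

Lemma card_eq_finset (X : finType) (A : {set X}) : [set` A] #= `I_#|A|.
Proof.
have [->|[x0 _]] := finset.set_0Vmem A.
  by rewrite cards0 II0 (_ : [set` _] = set0) //; apply/seteqP; split=> x //=; rewrite inE.
have <- : nth x0 (enum A) @` `I_#|A| = [set` A].
  apply/seteqP; split=> [_ [k /= kA <-]|x /= xA].
    by rewrite -mem_enum mem_nth // -cardE.
  by exists (index x (enum A)); rewrite /= ?cardE ?index_mem ?nth_index ?mem_enum.
apply: inj_card_eq => k l; rewrite !inE /= => kA lA /eqP.
by rewrite nth_uniq ?enum_uniq -?cardE // => /eqP.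
Qed.

Lemma card_orbits :
  tiling_orbits D #= `I_#|orbit tiling_action [set: sym]%SET @: [set: {ffun 'I_12 -> T}]%SET|.
Proof.
set O := _ @: _.
have -> : tiling_orbits D = (fun o : {set {ffun 'I_12 -> T}} => tiling_of @` [set` o]) @` [set` O].
  apply/seteqP; split=> [_ [tau _ <-]|_ [_ /imsetP[x _ ->] <-]].
    have [x <-] := tiling_of_surj tau; rewrite tiling_orbitE.
    by exists (orbit tiling_action [set: sym]%SET x) => //; apply/imsetP; exists x; rewrite ?inE.
  by exists (tiling_of x); rewrite ?tiling_orbitE.
apply: card_eq_trans (card_eq_finset O); apply: inj_card_eq => o1 o2 _ _.
move=> eq_o; apply/finset.setP=> x.
have := congr1 (fun S => S (tiling_of x)) eq_o.
by rewrite !(image_inj tiling_of_inj) /= => o12; apply/idP/idP; rewrite o12.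
Qed.

Lemma card_fixed u a b c :
    (forall v i, act_face i v = i ->
       #|returning design_action v i| = holonomy_weight a b c (holonomy_of (sym_code v))) ->
  #|('Fix_tiling_action[u])%g| = monomial a b c (profile (sym_code u)).
Proof.
move=> weight; pose l := sym_code u.
pose rep i : 'I_12 := Ordinal (list_root_lt l i).
have rep_inv i : rep (face_action i u) = rep i.
  apply: val_inj; rewrite /= -[val (sgval u i)](perm_at_code (sgval u)).
  by have [] := list_rootP i (sym_code_face_perms u).
have rep_conn i : fconnect (face_action^~ u) (rep i) i.
  have [_ /trajectP[k _ ik]] := list_rootP i (sym_code_face_perms u).
  suff {2}-> : i = iter k (face_action^~ u) (rep i) by apply: fconnect_iter.
  by apply: val_inj; rewrite ik (iter_perm_at_code (sgval u) k (rep i)).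
rewrite (card_fixed_tilings act_design_face ord0 rep_inv rep_conn).
rewrite -prod_holonomy_weight /holonomies big_map big_filter -val_enum_ord big_map big_enum_cond.
apply: eq_big => [i|i _]; first by rewrite -val_eqE.
rewrite weight; last first.
  by rewrite -[act_face i _]/(face_action i _) actX_iter iter_order //; apply: act_inj.
by rewrite /first_return sym_codeX (list_order_code (sgval u)).
Qed.

Lemma sym_mx1 : sym_mx 1%g = 1%:M.
Proof. exact: sym_word_mx1. Qed.

Lemma sym_mxM u v : sym_mx (u * v)%g = sym_mx v *m sym_mx u.
Proof. exact: sym_word_mxM. Qed.

Lemma sym_mx_inj : injective sym_mx.
Proof.
move=> u v uv; apply/val_inj/permP => i; apply: (@face_inj R).
by rewrite -[LHS]sym_mx_face uv sym_mx_face.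
Qed.

Lemma holonomy_of_sym u : holonomy_of (sym_code u) =
  if u == 1%g then Trivial else if (u * u)%g == 1%g then Reflection else Rotation.
Proof. by rewrite /sym_code holonomy_of_code -!val_eqE. Qed.

End Designs.

Theorem theorem12 (R : realType) (T : finType)
    (D : tile_designs (Ih R) (dodecahedron R) T)
    (F : faces (dodecahedron R)) (r f : 'M[R]_3)
    (r_stab : stabilizer (Ih R) (val F) r)
    (r_rot : rotates_face (2 * pi / 5) r (val F))
    (f_stab : stabilizer (Ih R) (val F) f)
    (f_refl : reflects_face f (val F))
    (t_id t_r t_f : nat)
    (t_idE : #|T| = t_id)
    (t_rE : #|fixed_designs D r F| = t_r)
    (t_fE : #|fixed_designs D f F| = t_f) :
  exists N : nat, tiling_orbits D #= `I_N /\
    N%:R = 1 / 120 *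
      (t_id%:R ^+ 12 + 24 * t_id%:R ^+ 2 * t_r%:R ^+ 2 + 20 * t_id%:R ^+ 4
       + 15 * t_id%:R ^+ 6 + t_id%:R ^+ 6 + 24 * t_r%:R * t_id%:R
       + 20 * t_id%:R ^+ 2 + 15 * t_id%:R ^+ 4 * t_f%:R ^+ 4) :> rat.
Proof.
have [i Fi] := facet_ex F; subst F.
have [[/Ih_sym_mx[u ru] ri] [/Ih_sym_mx[v fv] fi]] := (r_stab, f_stab).
rewrite /= in ri fi r_rot f_refl.
have act_of w A : A = sym_mx R w -> mx_image A (face i) = face i -> act_face i w = i.
  by move=> ->; rewrite sym_mx_face => /face_inj.
have ui := act_of _ _ ru ri; have vi := act_of _ _ fv fi.
have u_rot : holonomy_of (sym_code u) = Rotation.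
  have uu : (u * u == 1)%g = false.
    apply/eqP => uu; apply: (rotation_sqr_neq1 ri r_rot).
    by rewrite ru -sym_mxM uu sym_mx1.
  by rewrite holonomy_of_sym uu; case: (u =P 1%g) => // u1; rewrite u1 mulg1 eqxx in uu.
have v_refl : holonomy_of (sym_code v) = Reflection.
  have [ff f1] := reflection_order fi f_refl; rewrite holonomy_of_sym.
  case: eqP => [v1|_]; first by case: f1; rewrite fv v1 sym_mx1.
  have -> // : (v * v)%g = 1%g.
    by apply: (@sym_mx_inj R); rewrite sym_mxM -fv ff sym_mx1.
  by rewrite eqxx.
have weight w j : act_face j w = j ->
    #|returning (design_action D) w j| = holonomy_weight t_id t_r t_f (holonomy_of (sym_code w)).
  move=> wj; case w_hol: (holonomy_of (sym_code w)) => /=.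
  - have w1 : w = 1%g.
      by move: w_hol; rewrite holonomy_of_sym; case: eqP => // _; case: eqP.
    rewrite w1 -t_idE -cardsT; apply: eq_card => t.
    by rewrite !inE act1 eqxx.
  - rewrite -t_rE (returning_holonomy D wj ui) ?w_hol //.
    by apply: eq_card => t; rewrite (mem_returning D t ru ui).
  - rewrite -t_fE (returning_holonomy D wj vi) ?w_hol //.
    by apply: eq_card => t; rewrite (mem_returning D t fv vi).
have := card_orbits D; set N := #|_|; exists N; split=> //.
have := card_tiling_orbits (act_design_face D).
rewrite -/N (eq_bigr _ (fun w _ => card_fixed w weight)).
have card_sym : #|sym| = 120%N.
  by rewrite cardE -(size_map sym_code) (perm_size codes_face_perms).
rewrite card_sym -big_enum -(big_map sym_code xpredT (fun l => monomial _ _ _ (profile l))).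
rewrite (perm_big _ codes_face_perms) sum_monomials => /(congr1 (fun n => n%:R : rat)).
rewrite !(natrD, natrM, natrX) => sumE.
apply: (mulIf (_ : 120%:R != 0 :> rat)) => //; rewrite -sumE.
by field.
Qed.
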